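(* Let $p\geqslant 3$ and fix $\rho\in\mathbb{Z}_p^*$ not a square modulo $p$. Let $L$ be a $3$-dimensional solvable $\mathbb{Z}_p$-Lie lattice and let $\sigma$ be its self-similarity index. Then $\sigma=p$ or $\sigma=p^2$. Moreover, $\sigma=p$ if and only if $L$ is isomorphic to one of the following Lie lattices (presentations on generators $x_0,x_1,x_2$, always with $[x_1,x_2]=0$; $s,r,t\in\mathbb{N}=\{0,1,2,\dots\}$, $c\in\mathbb{Z}_p$, $\varepsilon\in\{0,1\}$): (0) $L_0$: $[x_0,x_1]=0$, $[x_0,x_2]=0$; (1) $L_1(s)$: $[x_0,x_1]=p^sx_1$, $[x_0,x_2]=p^sx_2$; (2) $L_2(s,r,c)$ with $r\geqslant 1$ and $v_p(c)=1$: $[x_0,x_1]=p^sx_1+p^{s+r}cx_2$, $[x_0,x_2]=p^{s+r}x_1+p^sx_2$; (4) $L_4(s,t,\varepsilon)$ with $t=1$, or with $t=0$ and $\varepsilon=0$: $[x_0,x_1]=p^{s+t}\rho^\varepsilon x_2$, $[x_0,x_2]=p^sx_1$; (5) $L_5(s,r,c)$ with $r\geqslant 1$ and $v_p(c)=1$, or with $r=0$ and $v_p(4c+1)=1$: $[x_0,x_1]=p^{s+r}x_1+p^scx_2$, $[x_0,x_2]=p^sx_1$.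
   Context: A $\mathbb{Z}_p$-Lie lattice is a $\mathbb{Z}_p$-Lie algebra whose underlying module is finitely generated and free; its dimension is its rank. A virtual endomorphism of $L$ is a homomorphism of algebras $\varphi:M\to L$ where $M\subseteq L$ is a finite-index subalgebra; its index is $[L:M]$. An ideal $I$ of $L$ is $\varphi$-invariant if $I$ is contained in the domain of every power $\varphi^n$ and $\varphi(I)\subseteq I$ (equivalently $I\subseteq M$ and $\varphi(I)\subseteq I$). $\varphi$ is simple if there is no non-zero $\varphi$-invariant ideal of $L$. $L$ is self-similar of index $p^k$ if there exists a simple virtual endomorphism of $L$ of index $p^k$. The self-similarity index of a self-similar $L$ is the smallest $p^k$ such that $L$ is self-similar of index $p^k$. $v_p$ is the $p$-adic valuation. *)

(* Defs.v *)
From HB Require Import structures.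
From Stdlib Require Import ProofIrrelevance FunctionalExtensionality.
From mathcomp Require Import all_boot all_order all_algebra.
From mathcomp Require Import boolp.
Set Implicit Arguments. Unset Strict Implicit. Unset Printing Implicit Defensive.
Import Order.TTheory GRing.Theory Num.Theory.
Local Open Scope ring_scope.

(* The ring Z_p of p-adic integers, as the inverse limit of the Z/p^n Z:     *)
(* an element is a coherent sequence (x_n)_n of residues, 0 <= x_n < p^n,    *)
(* with x_{n+1} = x_n mod p^n.                                               *)

Definition ppow (p : nat) (n : nat) : int := (p ^ n)%N%:Z.

Definition zp_ok (p : nat) (x : nat -> int) : Prop :=
  forall n, (x n %% ppow p n)%Z = x n /\ (x n.+1 %% ppow p n)%Z = x n.

Definition padic (p : nat) : Type := {x : nat -> int | zp_ok p x}.

HB.instance Definition _ p := gen_eqMixin (padic p).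
HB.instance Definition _ p := gen_choiceMixin (padic p).

Section ZpRing.
Variable p : nat.
Local Notation P := (ppow p).

Lemma ppow_dvd n : (P n %| P n.+1)%Z.
Proof. by rewrite /ppow dvdzE /= expnS dvdn_mull. Qed.

Lemma modz_dvdm (m d x : int) : (d %| m)%Z -> ((x %% m)%Z %% d)%Z = (x %% d)%Z.
Proof.
move=> /dvdzP [k ->].
rewrite {2}(divz_eq x (k * d)) mulrA modzMDl //.
Qed.

Definition coherent (f : nat -> int) := forall n, (f n.+1 = f n %[mod P n])%Z.

Lemma norm_ok f : coherent f -> zp_ok p (fun n => (f n %% P n)%Z).
Proof.
move=> hf n; split; first by rewrite modz_mod.
by rewrite modz_dvdm ?ppow_dvd // hf.
Qed.

Definition mkZp f (hf : coherent f) : padic p :=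
  exist _ (fun n => (f n %% P n)%Z) (norm_ok hf).

Lemma Zp_inj (x y : padic p) : (forall n, sval x n = sval y n) -> x = y.
Proof.
case: x => x hx; case: y => y hy /= e.
have exy : x = y by apply: functional_extensionality.
subst y; by rewrite (proof_irrelevance _ hx hy).
Qed.

Lemma val_mod (x : padic p) n : (sval x n %% P n)%Z = sval x n.
Proof. by case: (svalP x n). Qed.

Lemma val_coh (x : padic p) : coherent (sval x).
Proof. by move=> n; case: (svalP x n) => h1 h2; rewrite h2 h1. Qed.

Lemma coh_cst c : coherent (fun _ => c). Proof. by []. Qed.

Lemma coh_add (x y : padic p) : coherent (fun n => sval x n + sval y n).
Proof. by move=> n; rewrite -modzDm !val_coh modzDm. Qed.

Lemma coh_mul (x y : padic p) : coherent (fun n => sval x n * sval y n).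
Proof. by move=> n; rewrite -modzMm !val_coh modzMm. Qed.

Lemma coh_opp (x : padic p) : coherent (fun n => - sval x n).
Proof. by move=> n; rewrite -modzNm val_coh modzNm. Qed.

Definition zp0 : padic p := mkZp (coh_cst 0).
Definition zp1 : padic p := mkZp (coh_cst 1).
Definition zpadd (x y : padic p) : padic p := mkZp (coh_add x y).
Definition zpmul (x y : padic p) : padic p := mkZp (coh_mul x y).
Definition zpopp (x : padic p) : padic p := mkZp (coh_opp x).

Lemma zpaddA : associative zpadd.
Proof. by move=> x y z; apply: Zp_inj => n /=; rewrite modzDml modzDmr addrA. Qed.
Lemma zpaddC : commutative zpadd.
Proof. by move=> x y; apply: Zp_inj => n /=; rewrite addrC. Qed.
Lemma zpadd0 : left_id zp0 zpadd.
Proof. by move=> x; apply: Zp_inj => n /=; rewrite modzDml add0r val_mod. Qed.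
Lemma zpaddN : left_inverse zp0 zpopp zpadd.
Proof. by move=> x; apply: Zp_inj => n /=; rewrite modzDml addNr. Qed.

HB.instance Definition _ := GRing.isZmodule.Build (padic p) zpaddA zpaddC zpadd0 zpaddN.

Lemma zpmulA : associative zpmul.
Proof. by move=> x y z; apply: Zp_inj => n /=; rewrite modzMml modzMmr mulrA. Qed.
Lemma zpmulC : commutative zpmul.
Proof. by move=> x y; apply: Zp_inj => n /=; rewrite mulrC. Qed.
Lemma zpmul1 : left_id zp1 zpmul.
Proof. by move=> x; apply: Zp_inj => n /=; rewrite modzMml mul1r val_mod. Qed.
Lemma zpmulDl : left_distributive zpmul zpadd.
Proof.
move=> x y z; apply: Zp_inj => n /=.
by rewrite modzMml modzDm mulrDl.
Qed.

HB.instance Definition _ :=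
  GRing.Zmodule_isComPzRing.Build (padic p) zpmulA zpmulC zpmul1 zpmulDl.

End ZpRing.

(* Z_p-Lie lattices.  A Z_p-Lie lattice is a Z_p-module V (an lmodType over  *)
(* padic p) with a Lie bracket, whose underlying module is free of finite rank. *)

Section LieLattices.
Variables (p : nat) (V : lmodType (padic p)).
Implicit Types (br : V -> V -> V) (S M I : V -> Prop).

Definition lie_bracket br : Prop :=
  [/\ (forall a x y z, br (a *: x + y) z = a *: br x z + br y z),
      (forall a x y z, br x (a *: y + z) = a *: br x y + br x z),
      (forall x, br x x = 0) &
      (forall x y z, br x (br y z) + br y (br z x) + br z (br x y) = 0)].

Definition free_of_rank (n : nat) : Prop :=
  exists e : 'I_n -> V,
    forall v, exists! c : 'I_n -> padic p, v = \sum_(i < n) c i *: e i.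

Definition submodule S : Prop :=
  [/\ S 0, (forall x y, S x -> S y -> S (x + y)) & (forall a x, S x -> S (a *: x))].

Definition subalgebra br S : Prop :=
  submodule S /\ (forall x y, S x -> S y -> S (br x y)).

Definition lie_ideal br S : Prop :=
  submodule S /\ (forall x y, S y -> S (br x y)).

Definition span S : V -> Prop :=
  fun x => forall N, submodule N -> (forall y, S y -> N y) -> N x.

Fixpoint derived br (k : nat) : V -> Prop :=
  match k with
  | 0 => fun _ => True
  | k'.+1 => span (fun z => exists x y,
                     [/\ derived br k' x, derived br k' y & z = br x y])
  end.

Definition solvable br : Prop :=
  exists k, forall x, derived br k x -> x = 0.

Definition has_index M (n : nat) : Prop :=
  exists r : 'I_n -> V, forall v, exists! i : 'I_n, M (v - r i).

(* virtual endomorphism phi : M -> L, M a finite-index subalgebra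
   (phi is given as a map on V; only its restriction to M matters) *)
Definition virtual_endo br M (phi : V -> V) : Prop :=
  [/\ subalgebra br M, (exists n, has_index M n),
      (forall x y, M x -> M y -> phi (x + y) = phi x + phi y),
      (forall a x, M x -> phi (a *: x) = a *: phi x) &
      (forall x y, M x -> M y -> phi (br x y) = br (phi x) (phi y))].

Definition phi_invariant br M (phi : V -> V) I : Prop :=
  [/\ lie_ideal br I, (forall x, I x -> M x) & (forall x, I x -> I (phi x))].

Definition simple_ve br M (phi : V -> V) : Prop :=
  forall I, phi_invariant br M phi I -> forall x, I x -> x = 0.

Definition self_similar_of_index br (n : nat) : Prop :=
  exists M (phi : V -> V),
    [/\ virtual_endo br M phi, has_index M n & simple_ve br M phi].

Definition ss_index br (sigma : nat) : Prop :=
  (exists k, sigma = (p ^ k)%N /\ self_similar_of_index br (p ^ k)%N) /\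
  (forall k, self_similar_of_index br (p ^ k)%N -> (sigma <= p ^ k)%N).

End LieLattices.

Definition pdivides (p k : nat) (c : padic p) : Prop :=
  exists d : padic p, c = (p%:R) ^+ k * d.

Definition vp_eq (p : nat) (c : padic p) (k : nat) : Prop :=
  pdivides k c /\ ~ pdivides k.+1 c.

Definition i0 : 'I_3 := @Ordinal 3 0 isT.
Definition i1 : 'I_3 := @Ordinal 3 1 isT.
Definition i2 : 'I_3 := @Ordinal 3 2 isT.

Definition xb (p : nat) (i : 'I_3) : 'rV[padic p]_3 := \row_j (j == i)%:R.

(* Lie bracket on Z_p^3 with [x0,x1] = a, [x0,x2] = b, [x1,x2] = 0,
   extended bilinearly and alternatingly *)
Definition pres_br (p : nat) (a b : 'rV[padic p]_3) (u v : 'rV[padic p]_3) : 'rV[padic p]_3 :=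
  (u 0 i0 * v 0 i1 - u 0 i1 * v 0 i0) *: a + (u 0 i0 * v 0 i2 - u 0 i2 * v 0 i0) *: b.

Definition iso_pres (p : nat) (V : lmodType (padic p)) (br : V -> V -> V)
    (a b : 'rV[padic p]_3) : Prop :=
  exists f : V -> 'rV[padic p]_3,
    [/\ bijective f, (forall c x y, f (c *: x + y) = c *: f x + f y) &
        (forall x y, f (br x y) = pres_br a b (f x) (f y))].

Section Families.
Variable p : nat.
Local Notation pp := (p%:R : padic p).
Local Notation x1 := (xb p i1).
Local Notation x2 := (xb p i2).

(* each lattice is given by the pair ([x0,x1], [x0,x2]) *)
Definition L0 : 'rV[padic p]_3 * 'rV[padic p]_3 := (0, 0).
Definition L1 (s : nat) : 'rV[padic p]_3 * 'rV[padic p]_3 :=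
  (pp ^+ s *: x1, pp ^+ s *: x2).
Definition L2 (s r : nat) (c : padic p) : 'rV[padic p]_3 * 'rV[padic p]_3 :=
  (pp ^+ s *: x1 + (pp ^+ (s + r) * c) *: x2, pp ^+ (s + r) *: x1 + pp ^+ s *: x2).
Definition L4 (rho : padic p) (s t : nat) (eps : bool) : 'rV[padic p]_3 * 'rV[padic p]_3 :=
  ((pp ^+ (s + t) * (if eps then rho else 1)) *: x2, pp ^+ s *: x1).
Definition L5 (s r : nat) (c : padic p) : 'rV[padic p]_3 * 'rV[padic p]_3 :=
  (pp ^+ (s + r) *: x1 + (pp ^+ s * c) *: x2, pp ^+ s *: x1).
End Families.

Definition iso_to (p : nat) (V : lmodType (padic p)) (br : V -> V -> V)
    (L : 'rV[padic p]_3 * 'rV[padic p]_3) : Prop := iso_pres br L.1 L.2.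

(* Main.v *)
(* A solvable lattice of rank 3 has a basis x0, x1, x2 with [x1,x2] = 0 on whose span N the
   element x0 acts by a matrix A: solvability makes the three brackets of basis vectors
   dependent, and a primitive relation between them is a decomposable bivector.  Writing
   A = a + p^k C with C traceless and primitive, a cyclic vector puts C in companion form
   with C^2 = c.

   The map that is the identity on x0 and 1/p on N is simple of index p^2 as soon as A <> 0.

   For index p, let phi : M -> L be simple.  Except for the Heisenberg lattice, N is preserved
   by phi, so N is not contained in M, and after a change of basis M = <x0, v, p w> with
   N = <v, w>.  Then B = phi|N satisfies BA = uAB with u = 1, or with u = -1 and a = 0.
   If c had neither valuation 1 nor, in the second case, were a unit square, one of pN,
   <v, p w> or an eigenline of C (found by Hensel's lemma) would be an invariant ideal.
   Conversely B = C^-1, respectively an exchange of the two eigenlines of C followed by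
   a division by p, gives a simple phi of index p; the values of c that occur are the
   listed families. *)
Require Import Defs.
From HB Require Import structures.
From mathcomp Require Import all_boot all_order all_algebra.
From mathcomp Require Import boolp ring zify.
Set Implicit Arguments. Unset Strict Implicit. Unset Printing Implicit Defensive.
Import Order.TTheory GRing.Theory Num.Theory.
Local Open Scope ring_scope.

(** * p-adic integers *)

Section PadicIntegers.
Variables (p : nat) (p_prime : prime p).
Local Notation R := (padic p).
Local Notation pi := (p%:R : R).
Local Notation P := (ppow p).

(** Since [phi] lives only on [M], the obstruction works with [psi], which is [phi] after
    multiplication by [p]: it is defined everywhere because [p V] lies in [M]. Simplicity makes
    [psi] injective, as [p] times its kernel would be an invariant ideal. If [psi] preserves [N]
    with matrix [B] and has coefficient [w] on [x0], the bracket gives [p B A = w A B]; as [B] has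
    non-zero determinant, traces and determinants yield [(p - w) tr A = 0] and
    [(p^2 - w^2) det A = 0]. Hence [w] is [p] or [-p], the latter only for trace zero: this is the
    origin of the sign [u]. For nilpotent [A] both equations are void and [N] need not be preserved,
    so the Heisenberg lattice is treated through its centre. The number [c] is minus the determinant
    of [C]. It keeps its value in a basis of [N] adapted to [M], so the obstruction can be read off
    there. An odd [p] makes 2 invertible, which is needed to split off half the trace and to extract
    square roots. *)

Definition is_unit (x : R) := exists y, x * y = 1.
Definition pdvd (x : R) := exists y, x = pi * y.

Lemma sval_add (x y : R) n : sval (x + y) n = ((sval x n + sval y n) %% P n)%Z.
Proof. by []. Qed.

Lemma sval_mul (x y : R) n : sval (x * y) n = ((sval x n * sval y n) %% P n)%Z.
Proof. by []. Qed.

Lemma sval_opp (x : R) n : sval (- x) n = ((- sval x n) %% P n)%Z.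
Proof. by []. Qed.

Lemma sval_nat m n : sval (m%:R : R) n = (m%:Z %% P n)%Z.
Proof.
elim: m => [|m IH]; first by [].
by rewrite -natr1 sval_add IH -[sval (1 : R) n]/((1 %% P n)%Z) modzDm -PoszD addn1.
Qed.

Lemma sval_mod (x : R) m n : (m <= n)%N -> (sval x n %% P m)%Z = sval x m.
Proof.
elim: n => [|n IH]; first by rewrite leqn0 => /eqP ->; exact: val_mod.
rewrite leq_eqVlt => /predU1P [->|]; first exact: val_mod.
rewrite ltnS => mn; rewrite -(IH mn) -(proj2 (svalP x n)) modz_dvdm //.
by rewrite /ppow dvdzE /= dvdn_exp2l.
Qed.

Lemma Pgt0 n : 0 < P n.
Proof. by rewrite /ppow ltz_nat expn_gt0 prime_gt0. Qed.

Lemma sval_range (x : R) n : 0 <= sval x n < P n.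
Proof.
by rewrite -val_mod modz_ge0 ?ltz_pmod ?gt_eqF ?Pgt0.
Qed.

Lemma pexpE n : pi ^+ n = (p ^ n)%:R.
Proof. by rewrite natrX. Qed.

(** Separatedness of the [p]-adic topology. Every simplicity proof below ends here: coordinates of
    an invariant ideal are shown to be divisible by all powers of [p]. *)
Lemma padic_eq0_dvd (x : R) : (forall n, exists y, x = pi ^+ n * y) -> x = 0.
Proof.
move=> h; apply: Zp_inj => n; have [y ->] := h n.
by rewrite sval_mul pexpE sval_nat /ppow modzz mul0r.
Qed.

(** The index shifts by one: if [p^(n+1)] divides [p x_(n+1)], then [p^n] divides [x_(n+1)], whose
    reduction is [x_n]. *)
Lemma pmul_eq0 (x : R) : pi * x = 0 -> x = 0.
Proof.
move=> h; apply: Zp_inj => n.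
have := congr1 (fun z : R => sval z n.+1) h.
rewrite sval_mul sval_nat -[sval (0 : R) n.+1]/((0 %% P n.+1)%Z) modzMml mod0z.
have PS : P n.+1 = p%:Z * P n by rewrite /ppow expnS PoszM.
have p0 : p%:Z != 0 by rewrite eqz_nat -lt0n prime_gt0.
move/dvdz_mod0P; rewrite PS dvdz_mul2l // => /dvdz_mod0P; rewrite sval_mod // => ->.
by rewrite -[sval (0 : R) n]/((0 %% P n)%Z) mod0z.
Qed.

(** Division by [p] loses one digit, so the quotient is built from [x_(n+1) / p] at level [n]. *)
Lemma pdvd_sval (x : R) : sval x 1 = 0 -> pdvd x.
Proof.
move=> h.
have p0 : p%:Z != 0 by rewrite eqz_nat -lt0n prime_gt0.
have PS n : P n.+1 = p%:Z * P n by rewrite /ppow expnS PoszM.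
have xd n : (p%:Z %| sval x n.+1)%Z.
  by apply/dvdz_mod0P; apply: etrans h; rewrite -(@sval_mod x 1 n.+1) // /ppow expn1.
have E n : sval x n.+1 = p%:Z * (sval x n.+1 %/ p%:Z)%Z.
  by rewrite mulrC divzK.
have coh : coherent p (fun n => (sval x n.+1 %/ p%:Z)%Z).
  move=> n; apply/eqP; rewrite eqz_mod_dvd -(dvdz_mul2l p0) mulrBr -!E -PS.
  by rewrite -eqz_mod_dvd val_coh.
exists (mkZp coh); apply: Zp_inj => n.
rewrite sval_mul sval_nat /= modzMml modzMmr -E.
by rewrite sval_mod.
Qed.

(** The inverse is assembled from Bezout coefficients of [x_n] and [p^n]. They are coherent because
    an inverse modulo [p^n] is unique. *)
Lemma unit_sval (x : R) : sval x 1 != 0 -> is_unit x.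
Proof.
move=> h.
have cop n : coprimez (sval x n) (P n).
  case: n => [|n]; first by rewrite /ppow expn0 coprimezE coprimen1.
  rewrite /ppow coprimezE /= coprime_sym coprimeXl // prime_coprime //.
  apply: contra h => hd.
  have : (P 1 %| sval x n.+1)%Z by rewrite /ppow expn1.
  by move/dvdz_mod0P; rewrite (@sval_mod x 1) // => ->.
pose f n := (egcdz (sval x n) (P n)).1.
have fE n : (f n * sval x n = 1 %[mod P n])%Z.
  rewrite /f; case: egcdzP => u v /= e _.
  have -> : u * sval x n = 1 - v * P n.
    by rewrite -(eqP (cop n)) -e addrK.
  by rewrite -mulNr addrC modzMDl.
have coh : coherent p f.
  move=> n.
  have e : (f n.+1 * sval x n = 1 %[mod P n])%Z.
    have /eqP := fE n.+1; rewrite eqz_mod_dvd => h1.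
    apply/eqP; rewrite eqz_mod_dvd.
    have d1 : (P n %| f n.+1 * sval x n.+1 - 1)%Z by apply: dvdz_trans h1; exact: ppow_dvd.
    have /eqP := val_coh x n; rewrite eqz_mod_dvd => h2.
    have -> : f n.+1 * sval x n - 1 = (f n.+1 * sval x n.+1 - 1) - f n.+1 * (sval x n.+1 - sval x n) by ring.
    by rewrite rpredB // dvdz_mull.
  apply/eqP; rewrite eqz_mod_dvd -(@Gauss_dvdzl _ _ (sval x n)); last by rewrite coprimez_sym; exact: cop.
  by rewrite mulrBl -eqz_mod_dvd e fE.
exists (mkZp coh); apply: Zp_inj => n.
by rewrite sval_mul /= modzMmr mulrC fE.
Qed.

Lemma unit_or_pdvd (x : R) : is_unit x \/ pdvd x.
Proof.
by case: (eqVneq (sval x 1) 0) => h; [right; exact: pdvd_sval|left; exact: unit_sval].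
Qed.

Lemma pdvdE (x : R) : pdvd x <-> sval x 1 = 0.
Proof.
split=> [[y ->]|]; last exact: pdvd_sval.
by rewrite sval_mul sval_nat /ppow expn1 modzz mul0r mod0z.
Qed.

Lemma p_not_unit : ~ is_unit pi.
Proof.
case=> y h; have := congr1 (fun z : R => sval z 1) h.
rewrite sval_mul sval_nat /ppow expn1 modzz mul0r mod0z.
rewrite -[sval (1 : R) 1]/((1 %% P 1)%Z) /ppow expn1 modz_small //.
by rewrite /= ltz_nat prime_gt1.
Qed.

Lemma unit_pdvdF (x : R) : is_unit x -> pdvd x -> False.
Proof.
by case=> y h [z e]; apply: p_not_unit; exists (z * y); rewrite mulrA -e.
Qed.

Lemma is_unitM x y : is_unit x -> is_unit y -> is_unit (x * y).
Proof. by move=> [a ha] [b hb]; exists (a * b); rewrite mulrACA ha hb mulr1. Qed.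

Lemma is_unitMl x y : is_unit (x * y) -> is_unit x.
Proof. by case=> z h; exists (y * z); rewrite mulrA. Qed.

Lemma is_unitMr x y : is_unit (x * y) -> is_unit y.
Proof. by rewrite mulrC; exact: is_unitMl. Qed.

Lemma pdvd0 : pdvd 0. Proof. by exists 0; rewrite mulr0. Qed.
Lemma pdvdD x y : pdvd x -> pdvd y -> pdvd (x + y).
Proof. by move=> [a ->] [b ->]; exists (a + b); rewrite mulrDr. Qed.
Lemma pdvdN x : pdvd x -> pdvd (- x).
Proof. by move=> [a ->]; exists (- a); rewrite mulrN. Qed.
Lemma pdvdB x y : pdvd x -> pdvd y -> pdvd (x - y).
Proof. by move=> hx hy; apply: pdvdD => //; exact: pdvdN. Qed.
Lemma pdvdMr x y : pdvd x -> pdvd (x * y).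
Proof. by move=> [a ->]; exists (a * y); rewrite mulrA. Qed.
Lemma pdvdMl x y : pdvd y -> pdvd (x * y).
Proof. by rewrite mulrC; exact: pdvdMr. Qed.
Lemma pdvdp x : pdvd (pi * x). Proof. by exists x. Qed.

Lemma pdvd_mul x y : pdvd (x * y) -> pdvd x \/ pdvd y.
Proof.
move=> h; case: (unit_or_pdvd x) => hx; last by left.
case: (unit_or_pdvd y) => hy; last by right.
by case: (unit_pdvdF (is_unitM hx hy) h).
Qed.

Lemma pdvd_mul_unit u x : is_unit u -> pdvd (u * x) -> pdvd x.
Proof. by move=> hu /pdvd_mul [/(unit_pdvdF hu)|]. Qed.

Lemma is_unit_pdvdD x y : is_unit x -> pdvd y -> is_unit (x + y).
Proof.
move=> hx hy; case: (unit_or_pdvd (x + y)) => // h.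
by case: (unit_pdvdF hx); rewrite -(addrK y x); apply: pdvdB.
Qed.

Lemma is_unitN x : is_unit x -> is_unit (- x).
Proof. by case=> y h; exists (- y); rewrite mulrNN. Qed.

Lemma pmul_inj (x y : R) : pi * x = pi * y -> x = y.
Proof. by move=> h; apply: subr0_eq; apply: pmul_eq0; rewrite mulrBr h subrr. Qed.

Lemma unit_mul_inj u x y : is_unit u -> u * x = u * y -> x = y.
Proof.
case=> v h e; rewrite -(mul1r x) -(mul1r y) -h.
by rewrite (mulrC u) -!mulrA e.
Qed.

Lemma padic_val (x : R) : x <> 0 -> exists k u, is_unit u /\ x = pi ^+ k * u.
Proof.
move=> nz; apply: contrapT => h; apply: nz; apply: padic_eq0_dvd.
elim=> [|n [y e]]; first by exists x; rewrite mul1r.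
case: (unit_or_pdvd y) => [hy|[z ez]]; first by case: h; exists n, y.
by exists z; rewrite exprSr -mulrA -ez.
Qed.

Lemma pexp_mul_eq0 k (x : R) : pi ^+ k * x = 0 -> x = 0.
Proof.
by elim: k => [|k IH]; rewrite ?mul1r // exprS -mulrA => /pmul_eq0.
Qed.

Lemma pexp_inj k (x y : R) : pi ^+ k * x = pi ^+ k * y -> x = y.
Proof. by move=> h; apply: subr0_eq; apply: (@pexp_mul_eq0 k); rewrite mulrBr h subrr. Qed.

Lemma padic_mul_eq0 (x y : R) : x * y = 0 -> x <> 0 -> y = 0.
Proof.
move=> e /padic_val [k [u [hu ex]]]; move: e; rewrite ex -mulrA => /pexp_mul_eq0 e.
by apply: (unit_mul_inj hu); rewrite e mulr0.
Qed.

Lemma padic_mulI (x y z : R) : x <> 0 -> x * y = x * z -> y = z.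
Proof.
by move=> nz e; apply: subr0_eq; apply: (@padic_mul_eq0 x) => //; rewrite mulrBr e subrr.
Qed.

Lemma is_unit_neq0 x : is_unit x -> x <> 0.
Proof. by move=> h e; case: (unit_pdvdF h); rewrite e; exact: pdvd0. Qed.

(** The valuation ring property. It decides which of two coordinates can be used to eliminate the
    other. *)
Lemma pdvd_total (x y : R) : (exists q, y = q * x) \/ (exists q, x = q * y).
Proof.
case: (pselect (x = 0)) => [->|/padic_val [k [u [[u' hu] ->]]]].
  by right; exists 0; rewrite mul0r.
case: (pselect (y = 0)) => [->|/padic_val [l [v [[v' hv] ->]]]].
  by left; exists 0; rewrite mul0r.
case/orP: (leq_total k l) => h.
  left; exists (pi ^+ (l - k) * (v * u')).
  rewrite -{1}(subnKC h) exprD.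
  transitivity (pi ^+ k * pi ^+ (l - k) * v * (u * u')); last by move: (pi ^+ k) (pi ^+ _) => q r; ring.
  by rewrite hu mulr1.
right; exists (pi ^+ (k - l) * (u * v')).
rewrite -{1}(subnKC h) exprD.
transitivity (pi ^+ l * pi ^+ (k - l) * u * (v * v')); last by move: (pi ^+ l) (pi ^+ _) => q r; ring.
by rewrite hv mulr1.
Qed.

Lemma residue (x : R) : exists i : 'I_p, pdvd (x - (i : nat)%:R).
Proof.
have := sval_range x 1; case e : (sval x 1) => [m|m] //; rewrite /ppow expn1 ltz_nat => /andP [_ h].
exists (Ordinal h); apply: pdvd_sval.
by rewrite sval_add sval_opp sval_nat e modzNm modzDmr subrr mod0z.
Qed.

Lemma nat_unit (n : nat) : (0 < n < p)%N -> is_unit (n%:R : R).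
Proof.
case/andP => n0 np; apply: unit_sval; rewrite sval_nat /ppow expn1.
rewrite modz_small; last by rewrite /= ltz_nat.
by rewrite eqz_nat -lt0n.
Qed.

Lemma residue_uniq (i j : 'I_p) : pdvd ((i : nat)%:R - (j : nat)%:R) -> i = j.
Proof.
wlog h : i j / (i <= j)%N.
  move=> H; case/orP: (leq_total i j) => h; first exact: H.
  by move=> d; symmetry; apply: H => //; rewrite -opprB; apply: pdvdN.
move=> d; apply: val_inj; apply/eqP; rewrite eqn_leq h /=.
rewrite leqNgt; apply/negP => lt.
have hu : is_unit ((j - i)%N%:R : R).
  by apply: nat_unit; rewrite subn_gt0 lt /= (leq_ltn_trans (leq_subr _ _)) // ltn_ord.
by apply: (unit_pdvdF hu); rewrite natrB // -opprB; apply: pdvdN.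
Qed.

(** * Completeness and square roots *)

Lemma padic_cauchy (s : nat -> R) :
  (forall n, exists y, s n.+1 - s n = pi ^+ n * y) ->
  exists l, forall n, exists y, l - s n = pi ^+ n * y.
Proof.
move=> hs.
have dv n (x y z : R) : x - y = pi ^+ n * z -> sval x n = sval y n.
  move=> e; have -> : x = y + pi ^+ n * z by rewrite -e addrC subrK.
  rewrite sval_add sval_mul pexpE sval_nat /ppow modzz mul0r mod0z addr0.
  exact: val_mod.
(* The limit is the diagonal sequence: the residue modulo [p^n] no longer changes after the term
   [s n]. *)
have coh : coherent p (fun n => sval (s n) n).
  move=> n; have [y /dv e] := hs n.
  by rewrite (@sval_mod _ n n.+1) // e val_mod.
exists (mkZp coh) => n.
have vd m : forall x : R, sval x m = 0 -> exists y, x = pi ^+ m * y.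
  elim: m => [|m IH] x e; first by exists x; rewrite mul1r.
  have [|y ey] := IH x; first by rewrite -(@sval_mod x m m.+1) // e mod0z.
  suff /pdvd_sval [z ez] : sval y 1 = 0 by exists z; rewrite exprSr -mulrA -ez.
  move: e; rewrite ey sval_mul pexpE sval_nat modzMml.
  have PS : P m.+1 = (p ^ m)%N%:Z * P 1 by rewrite /ppow expnSr PoszM expn1.
  move=> e; have {e} := e => /dvdz_mod0P; rewrite PS dvdz_mul2l ?eqz_nat -?lt0n ?expn_gt0 ?prime_gt0 //.
  by move/dvdz_mod0P; rewrite sval_mod.
apply: vd; rewrite sval_add sval_opp /= val_mod modzDmr subrr mod0z //.
Qed.

(* The iteration s |-> s + (d - s^2) / (2 c) with fixed slope gains one digit per step. *)
Lemma hensel_sqrt (d c : R) : is_unit (2%:R * c) -> pdvd (d - c ^+ 2) ->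
  exists g, g ^+ 2 = d /\ pdvd (g - c).
Proof.
case=> i hi hd.
pose F (s : R) := s + (d - s ^+ 2) * i.
pose s n := iter n F c.
have inv n : pdvd (s n - c) /\ exists y, d - s n ^+ 2 = pi ^+ n.+1 * y.
  elim: n => [|n [[z ez] [y ey]]].
    by split; [rewrite subrr; exact: pdvd0|case: hd => y ->; exists y; rewrite expr1].
  have E : s n.+1 = s n + pi ^+ n.+1 * y * i by rewrite /s iterS -/(s n) /F ey.
  split.
    by exists (z + pi ^+ n * y * i); rewrite E exprS mulrDr -ez; move: (pi ^+ n) => q; ring.
  exists (- (y * 2 * z * i) - pi ^+ n * y ^+ 2 * i ^+ 2).
  have sc : s n = c + pi * z by rewrite -ez addrC subrK.
  (* In this expansion [2 s_n i] is 1 modulo [p], because [i] inverts [2 c] and [s_n] is congruent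
     to [c]. The first two terms therefore cancel up to one more factor [p]. *)
  have -> : d - s n.+1 ^+ 2 = (d - s n ^+ 2) - 2%:R * s n * i * (pi ^+ n.+1 * y) - (pi ^+ n.+1 * y * i) ^+ 2.
    by rewrite E; move: (pi ^+ _) => q; ring.
  rewrite ey sc.
  have -> : 2%:R * (c + pi * z) * i = 1 + 2%:R * pi * z * i.
    transitivity (2%:R * c * i + 2%:R * pi * z * i); first by ring.
    by rewrite hi.
  by rewrite !exprS; move: (pi ^+ n) => q; ring.
have [n|g hg] := @padic_cauchy s.
  have [_ [y ey]] := inv n; exists (pi * (y * i)).
  by rewrite /s iterS -/(s n) /F addrC addKr ey exprSr; move: (pi ^+ n) => q; ring.
exists g; split.
  symmetry; apply: subr0_eq; apply: padic_eq0_dvd => n.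
  have [y ey] := hg n; have [_ [z ez]] := inv n.
  exists (pi * z - y * (g + s n)).
  have -> : d - g ^+ 2 = (d - s n ^+ 2) - (g - s n) * (g + s n) by ring.
  by rewrite ey ez exprS; move: (pi ^+ n) => q; ring.
have [y ey] := hg 1%N; have [[z ez] _] := inv 1%N.
by exists (y + z); rewrite mulrDr -ez -[pi]expr1 -ey; ring.
Qed.

(** * The residue field and the square classes of units *)

Definition res (x : R) : 'F_p := (sval x 1)%:~R.

Lemma intr_modFp (m : int) : ((m %% P 1)%Z%:~R : 'F_p) = m%:~R.
Proof.
have := divz_eq m (P 1); move: (m %/ _)%Z (m %% _)%Z => q r ->.
rewrite intrD intrM /ppow expn1.
by rewrite -[(Posz p)%:~R]pmulrn pchar_Fp_0 // mulr0 add0r.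
Qed.

Lemma resM x y : res (x * y) = res x * res y.
Proof. by rewrite /res sval_mul intr_modFp intrM. Qed.

Lemma resB x y : res (x - y) = res x - res y.
Proof. by rewrite /res sval_add sval_opp modzDmr intr_modFp intrD mulrNz. Qed.

Lemma res_eq0 x : res x = 0 <-> pdvd x.
Proof.
rewrite pdvdE; split=> [|h]; last by rewrite /res h.
rewrite /res; have := sval_range x 1; case e : (sval x 1) => [m|m] //.
rewrite /ppow expn1 ltz_nat => /andP [_ h]; rewrite -pmulrn => hm.
have : (p %| m)%N by rewrite (dvdn_pcharf (pchar_Fp p_prime)) hm.
case: m h {hm e} => // m h /dvdn_leq => /(_ isT); by rewrite leqNgt h.
Qed.

Lemma res_surj (a : 'F_p) : exists x, res x = a.
Proof.
exists (a : nat)%:R; rewrite /res sval_nat intr_modFp -pmulrn.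
by rewrite natr_Zp.
Qed.

(* [x |-> x^2] on one half of F_p and [x |-> a x^2] on the other half is injective. *)
Lemma Fp_nonsq_mul (a b : 'F_p) : odd p ->
  (forall c, a <> c ^+ 2) -> (forall c, b <> c ^+ 2) -> exists c, a * b = c ^+ 2.
Proof.
move=> oddp ha hb.
have vlt (x : 'F_p) : (x < p)%N by rewrite -{2}(Fp_cast p_prime) ltn_ord.
pose F (x : 'F_p) := if ((x : nat).*2 < p)%N then x ^+ 2 else a * x ^+ 2.
have a0 : a != 0 by apply/eqP => e; apply: (ha 0); rewrite e expr0n.
have half (x y : 'F_p) : x ^+ 2 = y ^+ 2 ->
    ((x : nat).*2 < p)%N = ((y : nat).*2 < p)%N -> x = y.
  move/eqP; rewrite eqf_sqr => /orP [/eqP //|/eqP e] hxy.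
  have d : (p %| x + y)%N.
    by rewrite (dvdn_pcharf (pchar_Fp p_prime)) natrD !natr_Zp e addNr.
  have [z|z] := posnP (x + y)%N.
    by apply: ord_inj; move/eqP: z; rewrite addn_eq0 => /andP [/eqP -> /eqP ->].
  have {d} := dvdnP d => -[k ek].
  (* Two representatives below [p/2] with positive sum add up to less than [p]; two above [p/2] have
     a sum strictly between [p] and [2p], because [p] is odd. Neither sum is a multiple of [p]. *)
  exfalso; have := vlt x; have := vlt y; move: oddp ek z hxy.
  by move: (x : nat) (y : nat) => i j; case: k => [|[|k]]; nia.
have Finj : injective F.
  move=> x y; rewrite /F; case: ifP => hx; case: ifP => hy e.
  - by apply: half => //; rewrite hx hy.
  - exfalso; case: (eqVneq y 0) => [y0|y0].
      by move: hy; rewrite y0 /= prime_gt0.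
    by apply: (ha (x / y)); rewrite expr_div_n e mulfK // expf_neq0.
  - exfalso; case: (eqVneq x 0) => [x0|x0].
      by move: hx; rewrite x0 /= prime_gt0.
    by apply: (ha (y / x)); rewrite expr_div_n -e mulfK // expf_neq0.
  - by apply: half; [apply: (mulfI a0)|rewrite hx hy].
have [G _ GK] := injF_bij Finj.
have := GK b; rewrite /F; case: ifP => _ e; first by case: (hb (G b)).
by exists (a * G b); rewrite -{1}e; ring.
Qed.

(** By Hensel's lemma, being a square is decided in the residue field. If [u] is not a square there,
    [rho u] is, and its root divided by [rho] serves as [e]. This normalizes the parameter of the
    family [L4]. *)
Lemma unit_sq_class (rho u : R) : (2 < p)%N -> is_unit rho ->
  (~ exists y, pdvd (rho - y ^+ 2)) -> is_unit u ->
  exists e, is_unit e /\ (u = e ^+ 2 \/ u = rho * e ^+ 2).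
Proof.
move=> p3 hrho nsq hu.
have u2 : is_unit (2%:R : R) by apply: nat_unit; rewrite p3.
have sq (w : R) : is_unit w -> (exists c : 'F_p, res w = c ^+ 2) -> exists e, is_unit e /\ w = e ^+ 2.
  move=> hw [c ec]; have [y ey] := res_surj c.
  have d : pdvd (w - y ^+ 2).
    by apply/res_eq0; rewrite resB expr2 resM ec ey expr2 subrr.
  have hy : is_unit y.
    case: (unit_or_pdvd y) => // hy; case: (unit_pdvdF hw).
    by rewrite -(subrK (y ^+ 2) w); apply: pdvdD => //; rewrite expr2; apply: pdvdMl.
  have [g [eg _]] := hensel_sqrt (is_unitM u2 hy) d.
  by exists g; split=> //; move: hw; rewrite -eg expr2; apply: is_unitMl.
case: (pselect (exists c : 'F_p, res u = c ^+ 2)) => [h|h].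
  by have [e [he eu]] := sq u hu h; exists e; split=> //; left.
have [|c|c ec|c ec] := @Fp_nonsq_mul (res rho) (res u).
- by case: (even_prime p_prime) => // e; move: p3; rewrite e.
- move=> ec; apply: nsq; have [y ey] := res_surj c; exists y.
  by apply/res_eq0; rewrite resB expr2 resM ec ey expr2 subrr.
- by apply: h; exists c.
have [e [he eu]] := sq (rho * u) (is_unitM hrho hu) (ex_intro _ c (etrans (resM _ _) ec)).
have [r hr] := hrho; exists (e * r); split.
  by apply: is_unitM => //; exists rho; rewrite mulrC.
right; transitivity ((rho * r) ^+ 2 * u); first by rewrite hr expr1n mul1r.
transitivity (rho * (rho * u) * r ^+ 2); first by ring.
by rewrite eu; ring.
Qed.

End PadicIntegers.

(** * Bases of rank 3 *)

Section Frames.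
Variables (p : nat) (p_prime : prime p) (V : lmodType (padic p)).
Local Notation R := (padic p).
Local Notation pi := (p%:R : R).

(** Coordinates are explicit scalars, so that each change of basis becomes a list of polynomial
    identities. *)
Definition comb (e0 e1 e2 : V) (a b c : R) : V := a *: e0 + b *: e1 + c *: e2.

Definition frame (e0 e1 e2 : V) : Prop :=
  (forall v, exists a b c, v = comb e0 e1 e2 a b c) /\
  (forall a b c, comb e0 e1 e2 a b c = 0 -> [/\ a = 0, b = 0 & c = 0]).

Lemma combD e0 e1 e2 a b c a' b' c' :
  comb e0 e1 e2 a b c + comb e0 e1 e2 a' b' c' = comb e0 e1 e2 (a + a') (b + b') (c + c').
Proof. by rewrite /comb !scalerDl addrACA; congr (_ + _); rewrite addrACA. Qed.

Lemma combZ e0 e1 e2 k a b c :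
  k *: comb e0 e1 e2 a b c = comb e0 e1 e2 (k * a) (k * b) (k * c).
Proof. by rewrite /comb !scalerDr !scalerA. Qed.

Lemma combN e0 e1 e2 a b c : - comb e0 e1 e2 a b c = comb e0 e1 e2 (- a) (- b) (- c).
Proof. by rewrite -scaleN1r combZ !mulN1r. Qed.

Lemma combB e0 e1 e2 a b c a' b' c' :
  comb e0 e1 e2 a b c - comb e0 e1 e2 a' b' c' = comb e0 e1 e2 (a - a') (b - b') (c - c').
Proof. by rewrite combN combD. Qed.

Lemma comb100 e0 e1 e2 : comb e0 e1 e2 1 0 0 = e0.
Proof. by rewrite /comb scale1r !scale0r !addr0. Qed.
Lemma comb010 e0 e1 e2 : comb e0 e1 e2 0 1 0 = e1.
Proof. by rewrite /comb scale1r !scale0r add0r addr0. Qed.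
Lemma comb001 e0 e1 e2 : comb e0 e1 e2 0 0 1 = e2.
Proof. by rewrite /comb scale1r !scale0r !add0r. Qed.
Lemma comb000 e0 e1 e2 : comb e0 e1 e2 0 0 0 = 0.
Proof. by rewrite /comb !scale0r !addr0. Qed.

Lemma comb_comb e0 e1 e2 m00 m01 m02 m10 m11 m12 m20 m21 m22 a b c :
  comb (comb e0 e1 e2 m00 m01 m02) (comb e0 e1 e2 m10 m11 m12)
       (comb e0 e1 e2 m20 m21 m22) a b c =
  comb e0 e1 e2 (a * m00 + b * m10 + c * m20) (a * m01 + b * m11 + c * m21)
       (a * m02 + b * m12 + c * m22).
Proof. by rewrite {1}/comb !combZ !combD. Qed.

Lemma frame_inj e0 e1 e2 a b c a' b' c' : frame e0 e1 e2 ->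
  comb e0 e1 e2 a b c = comb e0 e1 e2 a' b' c' -> [/\ a = a', b = b' & c = c'].
Proof.
move=> [_ inj] h; have /inj [] : comb e0 e1 e2 (a - a') (b - b') (c - c') = 0.
  by rewrite -combB h subrr.
by move=> /subr0_eq -> /subr0_eq -> /subr0_eq ->.
Qed.

Lemma frame_coords e0 e1 e2 : frame e0 e1 e2 ->
  exists X Y Z : V -> R, (forall v, v = comb e0 e1 e2 (X v) (Y v) (Z v)) /\
    (forall a b c, [/\ X (comb e0 e1 e2 a b c) = a, Y (comb e0 e1 e2 a b c) = b
                     & Z (comb e0 e1 e2 a b c) = c]).
Proof.
move=> fr; have [sp _] := fr.
have /choice [f hf] : forall v, exists t : R * R * R, v = comb e0 e1 e2 t.1.1 t.1.2 t.2.
  by move=> v; have [a [b [c e]]] := sp v; exists (a, b, c).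
exists (fun v => (f v).1.1), (fun v => (f v).1.2), (fun v => (f v).2); split=> // a b c.
by have [ha hb hc] := frame_inj fr (hf (comb e0 e1 e2 a b c)).
Qed.

Definition det3 (m00 m01 m02 m10 m11 m12 m20 m21 m22 : R) : R :=
  m00 * (m11 * m22 - m12 * m21) - m01 * (m10 * m22 - m12 * m20)
  + m02 * (m10 * m21 - m11 * m20).

(** Cramer's rule: new coordinates come from the adjugate divided by the determinant, and the same
    cofactors, applied to a vanishing combination, give independence. *)
Lemma frame_change e0 e1 e2 m00 m01 m02 m10 m11 m12 m20 m21 m22 :
  frame e0 e1 e2 -> is_unit (det3 m00 m01 m02 m10 m11 m12 m20 m21 m22) ->
  frame (comb e0 e1 e2 m00 m01 m02) (comb e0 e1 e2 m10 m11 m12)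
        (comb e0 e1 e2 m20 m21 m22).
Proof.
move=> [sp inj] hd; have [i hi] := hd; split=> [v|a b c].
  have [a [b [c ->]]] := sp v.
  exists (i * (a * (m11 * m22 - m12 * m21) + b * (m12 * m20 - m10 * m22) + c * (m10 * m21 - m11 * m20))).
  exists (i * (a * (m02 * m21 - m01 * m22) + b * (m00 * m22 - m02 * m20) + c * (m01 * m20 - m00 * m21))).
  exists (i * (a * (m01 * m12 - m02 * m11) + b * (m02 * m10 - m00 * m12) + c * (m00 * m11 - m01 * m10))).
  rewrite comb_comb; set D := det3 _ _ _ _ _ _ _ _ _ in hi.
  have K x : x = D * i * x by rewrite hi mul1r.
  by congr comb; rewrite [LHS]K /D /det3; ring.
rewrite comb_comb => /inj [h0 h1 h2].
set D := det3 _ _ _ _ _ _ _ _ _ in hd hi.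
have K x : D * x = 0 -> x = 0.
  by move=> h; apply: (unit_mul_inj hd); rewrite h mulr0.
split; apply: K; rewrite /D /det3.
- transitivity ((a * m00 + b * m10 + c * m20) * (m11 * m22 - m12 * m21) + (a * m01 + b * m11 + c * m21) * (m12 * m20 - m10 * m22) + (a * m02 + b * m12 + c * m22) * (m10 * m21 - m11 * m20)); first by ring.
  by rewrite h0 h1 h2; ring.
- transitivity ((a * m00 + b * m10 + c * m20) * (m02 * m21 - m01 * m22) + (a * m01 + b * m11 + c * m21) * (m00 * m22 - m02 * m20) + (a * m02 + b * m12 + c * m22) * (m01 * m20 - m00 * m21)); first by ring.
  by rewrite h0 h1 h2; ring.
- transitivity ((a * m00 + b * m10 + c * m20) * (m01 * m12 - m02 * m11) + (a * m01 + b * m11 + c * m21) * (m02 * m10 - m00 * m12) + (a * m02 + b * m12 + c * m22) * (m00 * m11 - m01 * m10)); first by ring.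
  by rewrite h0 h1 h2; ring.
Qed.

(** If all dependencies were trivial, the columns of cofactors, which are dependencies, would
    vanish. Then the minors of the first two rows vanish, so multiples of these rows are
    dependencies too and the first row is zero; but then [(1, 0, 0)] is a non-trivial dependency. *)
Lemma det3_eq0_dep m00 m01 m02 m10 m11 m12 m20 m21 m22 :
  det3 m00 m01 m02 m10 m11 m12 m20 m21 m22 = 0 ->
  exists a b c : R, ~ [/\ a = 0, b = 0 & c = 0] /\
    [/\ a * m00 + b * m10 + c * m20 = 0, a * m01 + b * m11 + c * m21 = 0
      & a * m02 + b * m12 + c * m22 = 0].
Proof.
move=> D0.
pose Q (a b c : R) := [/\ a * m00 + b * m10 + c * m20 = 0,
  a * m01 + b * m11 + c * m21 = 0 & a * m02 + b * m12 + c * m22 = 0].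
apply: contrapT => H.
have K (a b c : R) : Q a b c -> [/\ a = 0, b = 0 & c = 0].
  by move=> h; apply: contrapT => n; apply: H; exists a, b, c.
have n1 : (1 : R) <> 0 by apply: is_unit_neq0 => //; exists 1; rewrite mulr1.
have [|_ _ A0] := K (m11 * m22 - m12 * m21) (m02 * m21 - m01 * m22) (m01 * m12 - m02 * m11).
  by split; [rewrite -D0 /det3; ring|ring|ring].
have [|_ _ A1] := K (m12 * m20 - m10 * m22) (m00 * m22 - m02 * m20) (m02 * m10 - m00 * m12).
  by split; [ring|rewrite -D0 /det3; ring|ring].
have [|_ _ A2] := K (m10 * m21 - m11 * m20) (m01 * m20 - m00 * m21) (m00 * m11 - m01 * m10).
  by split; [ring|ring|rewrite -D0 /det3; ring].
have E0 : m00 = 0.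
  have [|_ h _] := K (- m10) m00 0; last by [].
  split; first by ring.
    by transitivity (m00 * m11 - m01 * m10); [ring|].
  by transitivity (- (m02 * m10 - m00 * m12)); [ring|rewrite A1 oppr0].
have E1 : m01 = 0.
  have [|_ h _] := K (- m11) m01 0; last by [].
  split; last first.
  - by transitivity (m01 * m12 - m02 * m11); [ring|].
  - by ring.
  by transitivity (- (m00 * m11 - m01 * m10)); [ring|rewrite A2 oppr0].
have E2 : m02 = 0.
  have [|_ h _] := K (- m12) m02 0; last by [].
  split; last by ring.
    by transitivity (m02 * m10 - m00 * m12); [ring|].
  by transitivity (- (m01 * m12 - m02 * m11)); [ring|rewrite A0 oppr0].
have [|h _ _] := K 1 0 0; last by case: n1.
by split; rewrite ?E0 ?E1 ?E2; ring.
Qed.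

Lemma primitive_triple (a b c : R) : ~ [/\ a = 0, b = 0 & c = 0] ->
  exists k a' b' c', [/\ a = pi ^+ k * a', b = pi ^+ k * b', c = pi ^+ k * c'
    & [\/ is_unit a', is_unit b' | is_unit c']].
Proof.
move=> nz; apply: contrapT => H; apply: nz.
suff h n : exists a' b' c', [/\ a = pi ^+ n * a', b = pi ^+ n * b' & c = pi ^+ n * c'].
  by split; apply: padic_eq0_dvd => n; have [a' [b' [c' [? ? ?]]]] := h n;
    [exists a'|exists b'|exists c'].
elim: n => [|n [a' [b' [c' [ea eb ec]]]]]; first by exists a, b, c; rewrite !mul1r.
have N : ~ [\/ is_unit a', is_unit b' | is_unit c'].
  by move=> h; apply: H; exists n, a', b', c'.
case: (unit_or_pdvd p_prime a') => [h|[a1 e1]]; first by case: N; constructor 1.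
case: (unit_or_pdvd p_prime b') => [h|[b1 f1]]; first by case: N; constructor 2.
case: (unit_or_pdvd p_prime c') => [h|[c1 g1]]; first by case: N; constructor 3.
by exists a1, b1, c1; rewrite exprSr -!mulrA -e1 -f1 -g1.
Qed.

End Frames.

(** * Normal form of the bracket *)

Section NormalForm.
Variables (p : nat) (p_prime : prime p) (p_ge3 : (3 <= p)%N).
Variables (V : lmodType (padic p)) (br : V -> V -> V) (Hlie : lie_bracket br).
Local Notation R := (padic p).
Local Notation pi := (p%:R : R).

Lemma brDl x y z : br (x + y) z = br x z + br y z.
Proof. by case: Hlie => h _ _ _; rewrite -[x]scale1r h !scale1r. Qed.
Lemma brDr x y z : br x (y + z) = br x y + br x z.
Proof. by case: Hlie => _ h _ _; rewrite -[y]scale1r h !scale1r. Qed.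
Lemma brxx x : br x x = 0. Proof. by case: Hlie. Qed.
Lemma br0l x : br 0 x = 0.
Proof. by apply: (addrI (br 0 x)); rewrite -brDl !addr0. Qed.
Lemma br0r x : br x 0 = 0.
Proof. by apply: (addrI (br x 0)); rewrite -brDr !addr0. Qed.
Lemma brZl a x y : br (a *: x) y = a *: br x y.
Proof. by case: Hlie => h _ _ _; rewrite -[a *: x]addr0 h br0l addr0. Qed.
Lemma brZr a x y : br x (a *: y) = a *: br x y.
Proof. by case: Hlie => _ h _ _; rewrite -[a *: y]addr0 h br0r addr0. Qed.
Lemma brC x y : br x y = - br y x.
Proof.
by apply/eqP; rewrite -addr_eq0; apply/eqP; have := brxx (x + y); rewrite brDl !brDr !brxx add0r addr0.
Qed.

(** The bracket depends linearly on the cross product of the coordinates. The cyclic order of the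
    three basic brackets keeps the signs uniform. *)
Lemma br_comb e0 e1 e2 a b c a' b' c' :
  br (comb e0 e1 e2 a b c) (comb e0 e1 e2 a' b' c') =
  comb (br e1 e2) (br e2 e0) (br e0 e1) (b * c' - c * b') (c * a' - a * c') (a * b' - b * a').
Proof.
set x := br e1 e2; set y := br e2 e0; set z := br e0 e1.
have l v : br (comb e0 e1 e2 a b c) v = comb (br e0 v) (br e1 v) (br e2 v) a b c.
  by rewrite /comb !brDl !brZl.
have r u : br u (comb e0 e1 e2 a' b' c') = comb (br u e0) (br u e1) (br u e2) a' b' c'.
  by rewrite /comb !brDr !brZr.
rewrite l !r !brxx (brC e1 e0) (brC e2 e1) (brC e0 e2) -/x -/y -/z.
have -> : comb 0 z (- y) a' b' c' = comb x y z 0 (- c') b'.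
  by rewrite /comb scaler0 scale0r !add0r scalerN scaleNr addrC.
have -> : comb (- z) 0 x a' b' c' = comb x y z c' 0 (- a').
  by rewrite /comb scaler0 scale0r !addr0 scalerN scaleNr addrC.
have -> : comb y (- x) 0 a' b' c' = comb x y z (- b') a' 0.
  by rewrite /comb scaler0 scale0r !addr0 scalerN scaleNr addrC.
by rewrite comb_comb; congr comb; ring.
Qed.

Lemma comb0l (x y : V) (a b c : R) : comb 0 x y a b c = b *: x + c *: y.
Proof. by rewrite /comb scaler0 add0r. Qed.

(** A semidirect product: [e0] acts on the abelian ideal [<e1, e2>] by a matrix whose entries are
    listed column by column. *)
Definition semi (e0 e1 e2 : V) (a11 a21 a12 a22 : R) : Prop :=
  [/\ frame e0 e1 e2, br e1 e2 = 0, br e0 e1 = comb e0 e1 e2 0 a11 a21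
    & br e0 e2 = comb e0 e1 e2 0 a12 a22].

Lemma semi_br e0 e1 e2 a11 a21 a12 a22 a b c a' b' c' :
  semi e0 e1 e2 a11 a21 a12 a22 ->
  br (comb e0 e1 e2 a b c) (comb e0 e1 e2 a' b' c') =
  comb e0 e1 e2 0 (a * (a11 * b' + a12 * c') - a' * (a11 * b + a12 * c))
                  (a * (a21 * b' + a22 * c') - a' * (a21 * b + a22 * c)).
Proof.
case=> _ h12 h01 h02; rewrite br_comb (brC e2) h12 h01 h02.
rewrite comb0l combN !combZ combD.
by congr comb; ring.
Qed.

(** The four equations say [k A X = X B], where the columns of [X] are the coordinates of [f1] and
    [f2]. Adding [s e1 + t e2] to [k e0] leaves the action unchanged, as [<e1, e2>] is abelian. *)
Lemma semi_change e0 e1 e2 f0 f1 f2 a11 a21 a12 a22 k s t x1 y1 x2 y2 b11 b21 b12 b22 :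
  semi e0 e1 e2 a11 a21 a12 a22 ->
  f0 = comb e0 e1 e2 k s t -> f1 = comb e0 e1 e2 0 x1 y1 -> f2 = comb e0 e1 e2 0 x2 y2 ->
  is_unit (k * (x1 * y2 - x2 * y1)) ->
  k * (a11 * x1 + a12 * y1) = b11 * x1 + b21 * x2 ->
  k * (a21 * x1 + a22 * y1) = b11 * y1 + b21 * y2 ->
  k * (a11 * x2 + a12 * y2) = b12 * x1 + b22 * x2 ->
  k * (a21 * x2 + a22 * y2) = b12 * y1 + b22 * y2 ->
  semi f0 f1 f2 b11 b21 b12 b22.
Proof.
move=> S -> -> -> hu h1 h2 h3 h4; have [fr _ _ _] := S; split.
- apply: frame_change => //.
  by congr is_unit: hu; rewrite /det3; ring.
- by rewrite (semi_br _ _ _ _ _ _ S) -(comb000 e0 e1 e2); congr comb; ring.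
- rewrite (semi_br _ _ _ _ _ _ S) comb_comb; congr comb; first by ring.
    by rewrite [0 * s]mul0r add0r -h1; ring.
  by rewrite [0 * t]mul0r add0r -h2; ring.
- rewrite (semi_br _ _ _ _ _ _ S) comb_comb; congr comb; first by ring.
    by rewrite [0 * s]mul0r add0r -h3; ring.
  by rewrite [0 * t]mul0r add0r -h4; ring.
Qed.

(** * Solvability and the abelian ideal *)

Lemma span_submodule (S : V -> Prop) : submodule (Defs.span S).
Proof.
split=> [N [] //|x y hx hy N sN h|a x hx N sN h].
  by have [_ hD _] := sN; apply: hD; [exact: hx|exact: hy].
by have [_ _ hZ] := sN; apply: hZ; exact: hx.
Qed.

Lemma submodule_comb (S : V -> Prop) e0 e1 e2 a b c : submodule S ->
  S e0 -> S e1 -> S e2 -> S (comb e0 e1 e2 a b c).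
Proof. by move=> [_ hD hZ] h0 h1 h2; apply: (hD); [apply: hD|]; apply: hZ. Qed.

(* If the brackets were independent, every derived term would contain a multiple of V. *)
Lemma solvable_dep (e0 e1 e2 : V) : frame e0 e1 e2 -> solvable br ->
  exists a b c, ~ [/\ a = 0, b = 0 & c = 0] /\ comb (br e1 e2) (br e2 e0) (br e0 e1) a b c = 0.
Proof.
move=> fr [k hk]; have [sp inj] := fr.
have [m00 [m01 [m02 h12]]] := sp (br e1 e2).
have [m10 [m11 [m12 h20]]] := sp (br e2 e0).
have [m20 [m21 [m22 h01]]] := sp (br e0 e1).
case: (pselect (det3 m00 m01 m02 m10 m11 m12 m20 m21 m22 = 0)) => [/(det3_eq0_dep p_prime)|nz].
  move=> [a [b [c [n [E0 E1 E2]]]]]; exists a, b, c; split=> //.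
  by rewrite h12 h20 h01 comb_comb E0 E1 E2 comb000.
exfalso; suff [q [qn hq]] : exists q : R, q <> 0 /\ forall v, derived br k (q *: v).
  by apply: qn; have := hk _ (hq e0); rewrite -[e0](comb100 e0 e1 e2) combZ => /inj []; rewrite mulr1.
elim: k {hk} => [|k [q [qn hq]]].
  by exists 1; split=> //; apply: (is_unit_neq0 p_prime); exists 1; rewrite mulr1.
have hb u v : derived br k.+1 ((q * q) *: br u v).
  move=> N sN; apply; exists (q *: u), (q *: v); split=> //.
  by rewrite brZl brZr scalerA.
set D := det3 _ _ _ _ _ _ _ _ _ in nz.
(* The next derived term contains [q^2] times every bracket, and the adjugate writes [D v] as a
   combination of the three basic brackets. *)
exists (q * q * D); split=> [|v].
  by move=> e; apply: nz; apply: (padic_mul_eq0 p_prime e) => e'; exact: (qn (padic_mul_eq0 p_prime e' qn)).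
have [a [b [c ->]]] := sp v.
set x := a * (m11 * m22 - m12 * m21) + b * (m12 * m20 - m10 * m22) + c * (m10 * m21 - m11 * m20).
set y := a * (m02 * m21 - m01 * m22) + b * (m00 * m22 - m02 * m20) + c * (m01 * m20 - m00 * m21).
set z := a * (m01 * m12 - m02 * m11) + b * (m02 * m10 - m00 * m12) + c * (m00 * m11 - m01 * m10).
have -> : (q * q * D) *: comb e0 e1 e2 a b c =
    comb ((q * q) *: br e1 e2) ((q * q) *: br e2 e0) ((q * q) *: br e0 e1) x y z.
  by rewrite h12 h20 h01 !combZ comb_comb /D /det3 /x /y /z; congr comb; ring.
by apply: (@submodule_comb (derived br k.+1)) => //; exact: span_submodule.
Qed.

Lemma comb_rot (e0 e1 e2 : V) (a b c : R) : comb e0 e1 e2 a b c = comb e1 e2 e0 b c a.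
Proof. by rewrite /comb -addrA addrC. Qed.

Lemma frame_rot (e0 e1 e2 : V) : frame e0 e1 e2 -> frame e1 e2 e0.
Proof.
move=> [sp inj]; split=> [v|a b c].
  by have [a [b [c ->]]] := sp v; exists b, c, a; rewrite comb_rot.
by rewrite -comb_rot => /inj [].
Qed.

Lemma frame_subst (e0 e1 e2 f0 f1 f2 : V) m00 m01 m02 m10 m11 m12 m20 m21 m22 :
  frame e0 e1 e2 -> f0 = comb e0 e1 e2 m00 m01 m02 -> f1 = comb e0 e1 e2 m10 m11 m12 ->
  f2 = comb e0 e1 e2 m20 m21 m22 -> is_unit (det3 m00 m01 m02 m10 m11 m12 m20 m21 m22) ->
  frame f0 f1 f2.
Proof. by move=> fr -> -> -> h; apply: frame_change. Qed.

Lemma comb_subst (e0 e1 e2 f0 f1 f2 : V) m00 m01 m02 m10 m11 m12 m20 m21 m22 a b c :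
  f0 = comb e0 e1 e2 m00 m01 m02 -> f1 = comb e0 e1 e2 m10 m11 m12 ->
  f2 = comb e0 e1 e2 m20 m21 m22 ->
  comb f0 f1 f2 a b c =
  comb e0 e1 e2 (a * m00 + b * m10 + c * m20) (a * m01 + b * m11 + c * m21)
       (a * m02 + b * m12 + c * m22).
Proof. by move=> -> -> ->; rewrite comb_comb. Qed.

Lemma frame_br0 (e0 e1 e2 : V) : frame e0 e1 e2 -> solvable br ->
  exists f0 f1 f2, frame f0 f1 f2 /\ br f1 f2 = 0.
Proof.
move=> fr sol; have [a [b [c [n h]]]] := solvable_dep fr sol.
have [k [a' [b' [c' [ea eb ec u]]]]] := primitive_triple p_prime n.
have {}h : comb (br e1 e2) (br e2 e0) (br e0 e1) a' b' c' = 0.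
  have [sp inj] := fr.
  have [x [y [z e]]] := sp (comb (br e1 e2) (br e2 e0) (br e0 e1) a' b' c').
  move: h; rewrite ea eb ec -combZ e combZ => /inj [h0 h1 h2].
  by rewrite (pexp_mul_eq0 p_prime h0) (pexp_mul_eq0 p_prime h1) (pexp_mul_eq0 p_prime h2) comb000.
have main g0 g1 g2 x y z : frame g0 g1 g2 -> is_unit z ->
    comb (br g1 g2) (br g2 g0) (br g0 g1) x y z = 0 ->
    exists f0 f1 f2, frame f0 f1 f2 /\ br f1 f2 = 0.
  move=> {}fr [i hi] {}h.
  (* The relation factors: [z] times [[g0 - (x/z) g2, g1 - (y/z) g2]] equals [x [g1,g2] + y [g2,g0]
     + z [g0,g1]]. *)
  exists (comb g0 g1 g2 0 0 1), (comb g0 g1 g2 1 0 (- (i * x))), (comb g0 g1 g2 0 1 (- (i * y))).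
  split; first by apply: frame_change => //; exists 1; rewrite /det3; ring.
  rewrite br_comb -[RHS](scaler0 _ i) -h combZ; congr comb; try ring.
  by rewrite (mulrC i) hi; ring.
case: u => u.
- by apply: (main e1 e2 e0 b' c' a') => //; [exact: frame_rot|rewrite -comb_rot].
- by apply: (main e2 e0 e1 c' a' b') => //; [do 2!apply: frame_rot|rewrite -2!comb_rot].
- exact: (main e0 e1 e2 a' b' c').
Qed.

Lemma semi_exists (e0 e1 e2 : V) : frame e0 e1 e2 -> solvable br ->
  exists f0 f1 f2 a11 a21 a12 a22, semi f0 f1 f2 a11 a21 a12 a22.
Proof.
move=> fr0 sol; have [{fr0}x0 [x1 [x2 [fr h12]]]] := frame_br0 fr0 sol.
have one : is_unit (1 : R) by exists 1; rewrite mulr1.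
(* Of the [x0]-components of [[x0,x1]] and [[x0,x2]], one divides the other. Subtracting a multiple
   of the corresponding vector clears the other component. *)
wlog [b1 [b2 h02]] : x0 x1 x2 fr h12 / exists b1 b2, br x0 x2 = comb x0 x1 x2 0 b1 b2.
  move=> W; have [sp _] := fr.
  have E0 := esym (comb100 x0 x1 x2); have E1 := esym (comb010 x0 x1 x2).
  have E2 := esym (comb001 x0 x1 x2).
  have [a [a1 [a2 h01]]] := sp (br x0 x1); have [b [b1 [b2 h02]]] := sp (br x0 x2).
  case: (pdvd_total p_prime a b) => -[q e].
    apply: (W x0 x1 (comb x0 x1 x2 0 (- q) 1)).
    + apply: (frame_subst fr E0 E1 erefl).
      by congr is_unit: one; rewrite /det3; ring.
    + by rewrite {1}/comb !brDr !brZr h12 brxx !scaler0 scale0r !addr0.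
    + exists (b1 - q * a1 + q * (b2 - q * a2)), (b2 - q * a2).
      rewrite (comb_subst _ _ _ E0 E1 erefl).
      rewrite {1}/comb !brDr !brZr brxx !scaler0 add0r h01 h02 !combZ combD.
      by congr comb; rewrite ?e; ring.
  apply: (W x0 x2 (comb x0 x1 x2 0 1 (- q))).
  + apply: (frame_subst fr E0 E2 erefl).
    by congr is_unit: (is_unitN one); rewrite /det3; ring.
  + by rewrite {1}/comb !brDr !brZr brxx (brC x2 x1) h12 oppr0 !scaler0 scale0r !add0r.
  + exists (a2 - q * b2 + q * (a1 - q * b1)), (a1 - q * b1).
    rewrite (comb_subst _ _ _ E0 E2 erefl).
    rewrite {1}/comb !brDr !brZr brxx !scaler0 add0r h01 h02 !combZ combD.
    by congr comb; rewrite ?e; ring.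
have E0 := esym (comb100 x0 x1 x2); have E1 := esym (comb010 x0 x1 x2).
have E2 := esym (comb001 x0 x1 x2).
have [sp inj] := fr; have [a0 [a1 [a2 h01]]] := sp (br x0 x1).
case: (pselect (a0 = 0)) => [e|n0].
  by exists x0, x1, x2, a1, a2, b1, b2; split; rewrite // h01 e.
(* In the Jacobi identity the term with [[x0,x2]] bracketed against [x1] vanishes, since [[x0,x2]]
   lies in the abelian span. What remains is [a0 [x0,x2] = 0]. *)
have h02' : br x0 x2 = 0.
  have [_ _ _ /(_ x0 x1 x2)] := Hlie.
  rewrite h12 br0r add0r (brC x2 x0) h01 h02.
  rewrite -{1}(comb010 x0 x1 x2) -{3}(comb001 x0 x1 x2) combN !br_comb h12 h01 (brC x2) h02.
  rewrite !comb0l !combN !combZ !combD => /inj [_ k1 k2].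
  rewrite -(comb000 x0 x1 x2); congr comb; apply: (@padic_mul_eq0 _ p_prime a0) => //.
    by apply: oppr_inj; rewrite oppr0 -[RHS]k1; ring.
  by apply: oppr_inj; rewrite oppr0 -[RHS]k2; ring.
(* Now [x2] is central. The new abelian ideal is spanned by [x2] and the vector obtained from
   [a0 x0 + a1 x1] by dividing out the coefficient that divides the other. *)
case: (pdvd_total p_prime a0 a1) => -[q e].
  exists x1, (comb x0 x1 x2 1 q 0), x2, (- a0), (- a2), 0, 0; split.
  + apply: (frame_subst fr E1 erefl E2).
    by congr is_unit: (is_unitN one); rewrite /det3; ring.
  + by rewrite /comb !brDl !brZl h02' h12 brxx !scaler0 !addr0.
  + rewrite (comb_subst _ _ _ E1 erefl E2).
    rewrite {1}/comb !brDr !brZr brxx h12 !scaler0 !addr0 scale1r (brC x1) h01 combN.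
    by congr comb; rewrite ?e; ring.
  + by rewrite comb000 h12.
exists x0, (comb x0 x1 x2 q 1 0), x2, a1, a2, 0, 0; split.
+ apply: (frame_subst fr E0 erefl E2).
  by congr is_unit: one; rewrite /det3; ring.
+ by rewrite /comb !brDl !brZl h02' h12 brxx !scaler0 !addr0.
+ rewrite (comb_subst _ _ _ E0 erefl E2).
  rewrite {1}/comb !brDr !brZr brxx h02' !scaler0 !addr0 add0r scale1r h01.
  by congr comb; rewrite ?e; ring.
+ by rewrite comb000 h02'.
Qed.

(** * Traceless part and companion form *)

Lemma two_unit : is_unit (2%:R : R).
Proof. by apply: nat_unit => //; rewrite p_ge3. Qed.

(* One of the vectors e2, e1, e1 + e2 is cyclic for a primitive traceless C. *)
Lemma semi_cyclic e0 e1 e2 a k c11 c12 c21 :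
  semi e0 e1 e2 (a + pi ^+ k * c11) (pi ^+ k * c21) (pi ^+ k * c12) (a - pi ^+ k * c11) ->
  [\/ is_unit c11, is_unit c12 | is_unit c21] ->
  exists f1 f2, semi e0 f1 f2 a (pi ^+ k * (c11 ^+ 2 + c12 * c21)) (pi ^+ k) a.
Proof.
move=> S u.
(* The required unit is the determinant of [(C v, v)] with [v = (x, y)]. In the basis [C v, v] the
   companion form follows from [C^2 = c11^2 + c12 c21]. *)
suff [x [y hu]] : exists x y, is_unit ((c11 * x + c12 * y) * y - x * (c21 * x - c11 * y)).
  exists (comb e0 e1 e2 0 (c11 * x + c12 * y) (c21 * x - c11 * y)), (comb e0 e1 e2 0 x y).
  apply: (semi_change S (esym (comb100 e0 e1 e2)) erefl erefl); rewrite ?mul1r //; move: (pi ^+ k) => q; ring.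
case: (unit_or_pdvd p_prime c12) => [h|h12].
  by exists 0, 1; congr is_unit: h; ring.
case: (unit_or_pdvd p_prime c21) => [h|h21].
  by exists 1, 0; congr is_unit: (is_unitN h); ring.
have u1 : is_unit c11 by case: u => // h; case: (unit_pdvdF p_prime h).
exists 1, 1; congr is_unit: (is_unit_pdvdD p_prime (is_unitM two_unit u1) (pdvdB h12 h21)); ring.
Qed.

Lemma normal_form : free_of_rank V 3 -> solvable br ->
  exists e0 e1 e2 a, semi e0 e1 e2 a 0 0 a \/
    exists k c, semi e0 e1 e2 a (pi ^+ k * c) (pi ^+ k) a.
Proof.
move=> [e he] sol.
have fr : frame (e i0) (e i1) (e i2).
  have E c : \sum_(i < 3) c i *: e i = comb (e i0) (e i1) (e i2) (c i0) (c i1) (c i2).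
    rewrite !big_ord_recl big_ord0 addr0 addrA /comb.
    by congr (_ *: e _ + _ *: e _ + _ *: e _); try congr c; apply: val_inj.
  split=> [v|a b c h].
    by have [f [-> _]] := he v; exists (f i0), (f i1), (f i2); rewrite E.
  pose f (i : 'I_3) := if i == i0 then a else if i == i1 then b else c.
  have [g [_ uniq_g]] := he 0.
  have E1 : g = f by apply: uniq_g; rewrite E.
  have E2 : g = (fun=> 0) by apply: uniq_g; rewrite E comb000.
  have E3 i : f i = 0 by rewrite -E1 E2.
  by split; [exact: (E3 i0)|exact: (E3 i1)|exact: (E3 i2)].
have [f0 [f1 [f2 [a11 [a21 [a12 [a22 S]]]]]]] := semi_exists fr sol.
have [h hh] := two_unit.
pose a := h * (a11 + a22); pose d := h * (a11 - a22).
have E1 : a11 = a + d by transitivity (2%:R * h * a11); [rewrite hh mul1r|rewrite /a /d; ring].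
have E2 : a22 = a - d by transitivity (2%:R * h * a22); [rewrite hh mul1r|rewrite /a /d; ring].
case: (pselect [/\ d = 0, a12 = 0 & a21 = 0]) => [[d0 z12 z21]|n].
  by exists f0, f1, f2, a; left; move: S; rewrite E1 E2 d0 z12 z21 addr0 subr0.
have [k [c11 [c12 [c21 [ed e12 e21 u]]]]] := primitive_triple p_prime n.
rewrite E1 E2 ed e12 e21 in S.
have [g1 [g2 S']] := semi_cyclic S u.
by exists f0, g1, g2, a; right; exists k, (c11 ^+ 2 + c12 * c21).
Qed.

End NormalForm.

(** * Constructions of simple virtual endomorphisms *)

Section IndexP.
Variables (p : nat) (p_prime : prime p).
Variables (V : lmodType (padic p)) (br : V -> V -> V) (Hlie : lie_bracket br).
Local Notation R := (padic p).
Local Notation pi := (p%:R : R).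

(** * Submodules of index 1, [p] and [p^2] *)

Lemma submoduleB (M : V -> Prop) x y : submodule M -> M x -> M y -> M (x - y).
Proof. by move=> [_ hD hZ] hx hy; apply: hD => //; rewrite -scaleN1r; apply: hZ. Qed.

(** Index 1 means [M = V], and then [V] itself is a non-zero invariant ideal. *)
Lemma index1_not_simple (e0 e1 e2 : V) : frame e0 e1 e2 -> ~ self_similar_of_index br 1.
Proof.
move=> [_ inj] [M [phi [[[sM _] _ _ _ _] [r hr] simp]]].
have Mall v : M v.
  have [i [hi _]] := hr v; have [j [hj _]] := hr 0.
  rewrite sub0r in hj; rewrite (ord1 i) -(ord1 j) in hi.
  by have := submoduleB sM hi hj; rewrite opprK subrK.
have e00 : e0 = 0 by apply: (simp (fun=> True)) => //; split=> //; split.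
have [|/(is_unit_neq0 p_prime) //] := inj 1 0 0; first by rewrite comb100.
by case; exists 1; rewrite mulr1.
Qed.

(** For [v] outside [M] the vectors [j v] with [j < p] lie in distinct cosets, because differences
    of distinct residues are units. By counting they represent all cosets, so [V/M] is a line over
    the residue field. *)
Lemma index_p_cyclic (M : V -> Prop) : submodule M -> has_index M p ->
  [/\ exists v, ~ M v, forall v w, ~ M v -> exists j, M (w - j *: v)
    & forall v, M (pi *: v)].
Proof.
move=> sM [r hr]; have [M0 MD MZ] := sM.
have scale_unit u v : is_unit u -> M (u *: v) -> M v.
  by case=> i hi /(MZ i); rewrite scalerA mulrC hi scale1r.
have /choice [idx hidx] : forall v, exists i, M (v - r i).
  by move=> v; have [i [hi _]] := hr v; exists i.
have gen v w : ~ M v -> exists j : 'I_p, M (w - (j : nat)%:R *: v).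
  move=> nv; pose g (j : 'I_p) := idx ((j : nat)%:R *: v).
  have ginj : injective g.
    move=> i j e; apply: contrapT => nij.
    have h : M (((i : nat)%:R - (j : nat)%:R) *: v).
      have := submoduleB sM (hidx ((i : nat)%:R *: v)) (hidx ((j : nat)%:R *: v)).
      by rewrite -/(g i) -/(g j) e opprB addrA subrK scalerBl.
    apply: nv; apply: scale_unit h.
    by case: (unit_or_pdvd p_prime ((i : nat)%:R - (j : nat)%:R)) => // /(residue_uniq p_prime).
  have [h _ hK] := injF_bij ginj.
  exists (h (idx w)).
  have := submoduleB sM (hidx w) (hidx ((h (idx w) : nat)%:R *: v)).
  by rewrite -/(g _) hK opprB addrA subrK.
have [v0 nv0] : exists v, ~ M v.
  apply: contrapT => h; have Mall v : M v by apply: contrapT => n; apply: h; exists v.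
  have [i [_ ui]] := hr 0.
  have E (j : 'I_p) : i = j by apply: ui.
  have := congr1 (@nat_of_ord p) (esym (E (Ordinal (prime_gt0 p_prime)))).
  by rewrite (E (Ordinal (prime_gt1 p_prime))).
split; first by exists v0.
  by move=> v w nv; have [j hj] := gen v w nv; exists (j : nat)%:R.
move=> v; case: (pselect (M v)) => [|nv]; first exact: MZ.
have [j hj] := gen v (pi *: v) nv.
have [j0|jn] := posnP (j : nat); first by move: hj; rewrite j0 scale0r subr0.
exfalso; apply: nv; apply: (@scale_unit (pi - (j : nat)%:R)); last by rewrite scalerBl.
rewrite addrC; apply: is_unit_pdvdD => //; last by exists 1; rewrite mulr1.
by apply: is_unitN; apply: nat_unit; rewrite ?jn ?ltn_ord.
Qed.

Lemma has_index_p (e0 e1 e2 : V) : frame e0 e1 e2 ->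
  has_index (fun v => exists a b d, v = comb e0 e1 e2 a b (pi * d)) p.
Proof.
move=> fr; have [sp _] := fr.
exists (fun i : 'I_p => comb e0 e1 e2 0 0 (i : nat)%:R) => v.
have [a [b [c ->]]] := sp v; have [i [d hd]] := residue p_prime c.
exists i; split; first by exists a, b, d; rewrite combB !subr0 hd.
move=> j [a' [b' [d' e]]]; apply: (residue_uniq p_prime).
move: e; rewrite combB => /(frame_inj fr) [_ _ e]; exists (d' - d).
by rewrite mulrBr -e -hd; ring.
Qed.

Lemma has_index_p2 (e0 e1 e2 : V) : frame e0 e1 e2 ->
  has_index (fun v => exists a b d, v = comb e0 e1 e2 a (pi * b) (pi * d)) (p ^ 2).
Proof.
move=> fr; have [sp _] := fr.
(* The two base [p] digits of the coset number are the residues of the last two coordinates. *)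
exists (fun i : 'I_(p ^ 2) => comb e0 e1 e2 0 (i %/ p)%:R (i %% p)%:R) => v.
have [a [b [c ->]]] := sp v.
have [i [b' hb]] := residue p_prime b; have [j [c' hc]] := residue p_prime c.
have lt : (i * p + j < p ^ 2)%N.
  have := ltn_ord i; have := ltn_ord j; rewrite -mulnn; nia.
have dq : ((i * p + j) %/ p = i)%N by rewrite divnMDl ?prime_gt0 // divn_small ?addn0.
have dm : ((i * p + j) %% p = j)%N by rewrite modnMDl modn_small.
exists (Ordinal lt); split; first by exists a, b', c'; rewrite /= dq dm combB subr0 hb hc.
move=> k [a' [b'' [c'' e]]]; apply: val_inj => /=.
move: e; rewrite combB => /(frame_inj fr) [_ e1' e2'].
have kq : (k %/ p < p)%N.
  by rewrite ltn_divLR ?prime_gt0 // mulnn.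
have km : (k %% p < p)%N by rewrite ltn_mod prime_gt0.
have -> : (i : nat) = (k %/ p)%N.
  apply: (congr1 (@nat_of_ord p) (_ : i = Ordinal kq)); apply: (residue_uniq p_prime).
  by exists (b'' - b') => /=; rewrite mulrBr -e1' -hb; ring.
have -> : (j : nat) = (k %% p)%N.
  apply: (congr1 (@nat_of_ord p) (_ : j = Ordinal km)); apply: (residue_uniq p_prime).
  by exists (c'' - c') => /=; rewrite mulrBr -e2' -hc; ring.
by rewrite -divn_eq.
Qed.

Lemma frame_map_p (e0 e1 e2 : V) (F : R -> R -> R -> V) : frame e0 e1 e2 ->
  exists phi : V -> V, forall a b d, phi (comb e0 e1 e2 a b (pi * d)) = F a b d.
Proof.
move=> fr.
have /choice [phi hphi] : forall v, exists w, forall a b d, v = comb e0 e1 e2 a b (pi * d) -> w = F a b d.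
  move=> v; case: (pselect (exists a b d, v = comb e0 e1 e2 a b (pi * d))) => [[a [b [d ->]]]|n].
    by exists (F a b d) => a' b' d' /(frame_inj fr) [-> -> /(pmul_inj p_prime) ->].
  (* Outside the domain the value is set to 0. *)
  by exists 0 => a b d e; case: n; exists a, b, d.
by exists phi => a b d; exact: hphi.
Qed.

(** The map multiplies [e0] by [u], sends [e1] to [e2] and [p e2] to [e e1]. Its square on
    [<e1, e2>] is [e/p], so invariance forces infinite divisibility of the last two coordinates. The
    equations relating [u], [e] and the entries of [A] express compatibility with the bracket; the
    scalar, ramified and split cases are all instances. *)
Lemma index_p_swap (e0 e1 e2 : V) a11 a21 a12 a22 u e b21 :
  semi br e0 e1 e2 a11 a21 a12 a22 -> is_unit e -> a21 = pi * b21 ->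
  u * a22 = a11 -> u * a11 = a22 -> u * a12 = e * b21 -> a12 = u * (e * b21) ->
  ~ [/\ a11 = 0, a21 = 0, a12 = 0 & a22 = 0] ->
  self_similar_of_index br p.
Proof.
move=> S ue ea21 h1 h2 h3 h4 nA; have [fr _ _ _] := S; have [sp inj] := fr.
have [phi hphi] := frame_map_p (fun a b d => comb e0 e1 e2 (u * a) (e * d) b) fr.
exists (fun v => exists a b d, v = comb e0 e1 e2 a b (pi * d)), phi.
split; last 1 first.
- move=> I [[[_ _ IZ] Ibr] IM Iphi].
  have dv n : forall a b c, I (comb e0 e1 e2 a b c) ->
      exists b' c', b = pi ^+ n * b' /\ c = pi ^+ n * c'.
    elim: n => [|n IH] a b c h; first by exists b, c; rewrite !mul1r.
    have [_ [_ [d /(frame_inj fr) [_ _ ec]]]] := IM _ h.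
    have h' := Iphi _ h; rewrite ec hphi in h'.
    have [_ [_ [b' /(frame_inj fr) [_ _ eb]]]] := IM _ h'.
    have h'' := Iphi _ h'; rewrite eb hphi in h''.
    have [x [y [ex ey]]] := IH _ _ _ h''; have [i hi] := ue.
    exists (i * x), (i * y); rewrite ec eb !exprS.
    split; rewrite -mulrA; congr (_ * _).
      by transitivity (i * (pi ^+ n * x)); [rewrite -ex mulrA (mulrC i) hi mul1r|move: (pi ^+ n) => q; ring].
    by transitivity (i * (pi ^+ n * y)); [rewrite -ey mulrA (mulrC i) hi mul1r|move: (pi ^+ n) => q; ring].
  have d0 a b c : I (comb e0 e1 e2 a b c) -> b = 0 /\ c = 0.
    by move=> h; split; apply: padic_eq0_dvd => n; have [x [y [? ?]]] := dv n _ _ _ h;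
      [exists x|exists y].
  move=> v; have [a [b [c ->]]] := sp v => h.
  have [b0 c0] := d0 _ _ _ h; rewrite b0 c0 in h *.
  suff -> : a = 0 by rewrite comb000.
  (* The ideal lies on the line of [e0]. Bracketing its element [a e0] with [e1] and [e2] produces
     [a] times the columns of [A], which must vanish. *)
  apply: contrapT => na; apply: nA.
  have := Ibr e1 _ h; rewrite -{1}(comb010 e0 e1 e2) (semi_br Hlie _ _ _ _ _ _ S) => /d0 [k1 k2].
  have := Ibr e2 _ h; rewrite -{1}(comb001 e0 e1 e2) (semi_br Hlie _ _ _ _ _ _ S) => /d0 [k3 k4].
  split; apply: (@padic_mul_eq0 _ p_prime a) => //; apply: oppr_inj; rewrite oppr0.
  + by rewrite -[RHS]k1; ring.
  + by rewrite -[RHS]k2; ring.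
  + by rewrite -[RHS]k3; ring.
  + by rewrite -[RHS]k4; ring.
- split.
  + split.
      split.
      * by exists 0, 0, 0; rewrite mulr0 comb000.
      * move=> _ _ [a [b [d ->]]] [a' [b' [d' ->]]].
        by exists (a + a'), (b + b'), (d + d'); rewrite combD mulrDr.
      * move=> k _ [a [b [d ->]]].
        by exists (k * a), (k * b), (k * d); rewrite combZ mulrCA.
    move=> _ _ [a [b [d ->]]] [a' [b' [d' ->]]].
    rewrite (semi_br Hlie _ _ _ _ _ _ S) ea21.
    exists 0, (a * (a11 * b' + a12 * (pi * d')) - a' * (a11 * b + a12 * (pi * d))).
    exists (a * (b21 * b' + a22 * d') - a' * (b21 * b + a22 * d)).
    by congr comb; ring.
  + by exists p; exact: has_index_p.
  + move=> _ _ [a [b [d ->]]] [a' [b' [d' ->]]].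
    by rewrite combD -mulrDr !hphi combD; congr comb; ring.
  + move=> k _ [a [b [d ->]]].
    by rewrite combZ mulrCA !hphi combZ; congr comb; ring.
  + move=> _ _ [a [b [d ->]]] [a' [b' [d' ->]]].
    rewrite !hphi !(semi_br Hlie _ _ _ _ _ _ S) ea21.
    have -> : a * (pi * b21 * b' + a22 * (pi * d')) - a' * (pi * b21 * b + a22 * (pi * d)) =
       pi * (a * (b21 * b' + a22 * d') - a' * (b21 * b + a22 * d)) by ring.
    rewrite hphi; congr comb; first by ring.
      rewrite -{1 2}h2.
      transitivity (a * (u * a11 * (e * d') + e * b21 * b') - a' * (u * a11 * (e * d) + e * b21 * b)); first by ring.
      by rewrite -h3; ring.
    rewrite -{1 2}h1 {1 2}h4; ring.
- exact: has_index_p.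
Qed.

(** Every submodule is now an ideal, so all three directions have to be divided. A cyclic shift of
    the coordinates does it: its cube is division by [p]. *)
Lemma index_p_abelian (e0 e1 e2 : V) : semi br e0 e1 e2 0 0 0 0 -> self_similar_of_index br p.
Proof.
move=> S; have [fr _ _ _] := S; have [sp inj] := fr.
have [phi hphi] := frame_map_p (fun a b d => comb e0 e1 e2 d a b) fr.
have br0 x y : br x y = 0.
  have [a [b [c ->]]] := sp x; have [a' [b' [c' ->]]] := sp y.
  by rewrite (semi_br Hlie _ _ _ _ _ _ S) -[RHS](comb000 e0 e1 e2); congr comb; ring.
exists (fun v => exists a b d, v = comb e0 e1 e2 a b (pi * d)), phi.
split; last 1 first.
- move=> I [_ IM Iphi].
  have dv n : forall a b c, I (comb e0 e1 e2 a b c) ->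
      exists a' b' c', [/\ a = pi ^+ n * a', b = pi ^+ n * b' & c = pi ^+ n * c'].
    elim: n => [|n IH] a b c h; first by exists a, b, c; rewrite !mul1r.
    have [_ [_ [d /(frame_inj fr) [_ _ ec]]]] := IM _ h.
    have h' := Iphi _ h; rewrite ec hphi in h'.
    have [_ [_ [b' /(frame_inj fr) [_ _ eb]]]] := IM _ h'.
    have h'' := Iphi _ h'; rewrite eb hphi in h''.
    have [_ [_ [a' /(frame_inj fr) [_ _ ea]]]] := IM _ h''.
    have h3 := Iphi _ h''; rewrite ea hphi in h3.
    have [x [y [z [ex ey ez]]]] := IH _ _ _ h3.
    by exists x, y, z; rewrite ec eb ea ex ey ez !exprS !mulrA.
  move=> v; have [a [b [c ->]]] := sp v => h.
  rewrite -(comb000 e0 e1 e2); congr comb; apply: padic_eq0_dvd => n;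
    have [x [y [z [? ? ?]]]] := dv n _ _ _ h; by [exists x|exists y|exists z].
- split.
  + split.
      split.
      * by exists 0, 0, 0; rewrite mulr0 comb000.
      * move=> _ _ [a [b [d ->]]] [a' [b' [d' ->]]].
        by exists (a + a'), (b + b'), (d + d'); rewrite combD mulrDr.
      * move=> k _ [a [b [d ->]]].
        by exists (k * a), (k * b), (k * d); rewrite combZ mulrCA.
    by move=> x y _ _; rewrite br0; exists 0, 0, 0; rewrite mulr0 comb000.
  + by exists p; exact: has_index_p.
  + move=> _ _ [a [b [d ->]]] [a' [b' [d' ->]]].
    by rewrite combD -mulrDr !hphi combD.
  + by move=> k _ [a [b [d ->]]]; rewrite combZ mulrCA !hphi combZ.
  + move=> x y _ _; rewrite !br0 -{1}(comb000 e0 e1 e2) -[X in comb _ _ _ _ _ X](mulr0 pi) hphi.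
    by rewrite comb000.
- exact: has_index_p.
Qed.

(** Dividing the abelian ideal by [p] respects a bracket that is linear in its coordinates. With
    [A = 0] the line of [e0] would be an invariant ideal. *)
Lemma index_p2 (e0 e1 e2 : V) a11 a21 a12 a22 :
  semi br e0 e1 e2 a11 a21 a12 a22 ->
  ~ [/\ a11 = 0, a21 = 0, a12 = 0 & a22 = 0] ->
  self_similar_of_index br (p ^ 2).
Proof.
move=> S nA; have [fr _ _ _] := S; have [sp inj] := fr.
have [phi hphi] : exists phi, forall a b d,
    phi (comb e0 e1 e2 a (pi * b) (pi * d)) = comb e0 e1 e2 a b d.
  have [X [Y [Z [hX hXc]]]] := frame_coords fr.
  (* [q] is division by [p] on multiples of [p], with value 0 elsewhere. *)
  have /choice [q hq] : forall x : R, exists y, forall z, x = pi * z -> y = z.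
    move=> x; case: (pselect (pdvd x)) => [[y ->]|n].
      by exists y => z /(pmul_inj p_prime).
    by exists 0 => z e; case: n; exists z.
  exists (fun v => comb e0 e1 e2 (X v) (q (Y v)) (q (Z v))) => a b d.
  by have [-> -> ->] := hXc a (pi * b) (pi * d); rewrite !(hq _ _ erefl).
exists (fun v => exists a b d, v = comb e0 e1 e2 a (pi * b) (pi * d)), phi.
split; last 1 first.
- move=> I [[[_ _ IZ] Ibr] IM Iphi].
  have dv n : forall a b c, I (comb e0 e1 e2 a b c) ->
      exists b' c', b = pi ^+ n * b' /\ c = pi ^+ n * c'.
    elim: n => [|n IH] a b c h; first by exists b, c; rewrite !mul1r.
    have [_ [b' [d /(frame_inj fr) [_ eb ec]]]] := IM _ h.
    have h' := Iphi _ h; rewrite ec eb hphi in h'.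
    have [x [y [ex ey]]] := IH _ _ _ h'.
    by exists x, y; rewrite ec eb ex ey !exprS !mulrA.
  have d0 a b c : I (comb e0 e1 e2 a b c) -> b = 0 /\ c = 0.
    by move=> h; split; apply: padic_eq0_dvd => n; have [x [y [? ?]]] := dv n _ _ _ h;
      [exists x|exists y].
  move=> v; have [a [b [c ->]]] := sp v => h.
  have [b0 c0] := d0 _ _ _ h; rewrite b0 c0 in h *.
  suff -> : a = 0 by rewrite comb000.
  apply: contrapT => na; apply: nA.
  have := Ibr e1 _ h; rewrite -{1}(comb010 e0 e1 e2) (semi_br Hlie _ _ _ _ _ _ S) => /d0 [k1 k2].
  have := Ibr e2 _ h; rewrite -{1}(comb001 e0 e1 e2) (semi_br Hlie _ _ _ _ _ _ S) => /d0 [k3 k4].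
  split; apply: (@padic_mul_eq0 _ p_prime a) => //; apply: oppr_inj; rewrite oppr0.
  + by rewrite -[RHS]k1; ring.
  + by rewrite -[RHS]k2; ring.
  + by rewrite -[RHS]k3; ring.
  + by rewrite -[RHS]k4; ring.
- have E a b d a' b' d' : br (comb e0 e1 e2 a (pi * b) (pi * d)) (comb e0 e1 e2 a' (pi * b') (pi * d')) =
    comb e0 e1 e2 0 (pi * (a * (a11 * b' + a12 * d') - a' * (a11 * b + a12 * d)))
                    (pi * (a * (a21 * b' + a22 * d') - a' * (a21 * b + a22 * d))).
    by rewrite (semi_br Hlie _ _ _ _ _ _ S); congr comb; ring.
  split.
  + split.
      split.
      * by exists 0, 0, 0; rewrite mulr0 comb000.
      * move=> _ _ [a [b [d ->]]] [a' [b' [d' ->]]].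
        by exists (a + a'), (b + b'), (d + d'); rewrite combD !mulrDr.
      * move=> k _ [a [b [d ->]]].
        by exists (k * a), (k * b), (k * d); rewrite combZ !(mulrCA k).
    move=> _ _ [a [b [d ->]]] [a' [b' [d' ->]]]; rewrite E; eexists _, _, _; reflexivity.
  + by exists (p ^ 2)%N; exact: has_index_p2.
  + move=> _ _ [a [b [d ->]]] [a' [b' [d' ->]]].
    by rewrite combD -!mulrDr !hphi combD.
  + by move=> k _ [a [b [d ->]]]; rewrite combZ !(mulrCA k) !hphi combZ.
  + move=> _ _ [a [b [d ->]]] [a' [b' [d' ->]]].
    by rewrite E !hphi (semi_br Hlie _ _ _ _ _ _ S).
- exact: has_index_p2.
Qed.

End IndexP.

(** * Obstructions in index p *)

(** A vector with vanishing minors against a primitive vector is a multiple of it. Applied to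
    traceless matrices, this shows that whatever commutes with [C] is a scalar plus a multiple of
    [C]. *)
Lemma parallel3 (p : nat) (c d e x y z : padic p) :
  d * x = c * y -> e * x = c * z -> e * y = d * z ->
  [\/ is_unit c, is_unit d | is_unit e] ->
  exists b, [/\ x = b * c, y = b * d & z = b * e].
Proof.
have K (r i s t u : padic p) : r * i = 1 -> s * t = r * u -> u = i * t * s.
  by move=> h1 h2; rewrite -mulrA (mulrC t) h2 mulrA (mulrC i) h1 mul1r.
move=> h1 h2 h3; case=> -[i hi].
- by exists (i * x); split; apply: (K c).
- by exists (i * y); split; apply: (K d).
- by exists (i * z); split; apply: (K e).
Qed.

Section Obstruction.
Variables (p : nat) (p_prime : prime p) (p_ge3 : (3 <= p)%N).
Variables (V : lmodType (padic p)) (br : V -> V -> V) (Hlie : lie_bracket br).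
Local Notation R := (padic p).
Local Notation pi := (p%:R : R).
Variables (M : V -> Prop) (phi : V -> V).
Hypotheses (ve : virtual_endo br M phi) (idx : has_index M p) (simp : simple_ve br M phi).

Let subM : submodule M. Proof. by case: ve => -[]. Qed.
Let phiD x y : M x -> M y -> phi (x + y) = phi x + phi y.
Proof. by case: ve => _ _ h _ _; exact: h. Qed.
Let phiZ a x : M x -> phi (a *: x) = a *: phi x.
Proof. by case: ve => _ _ _ h _; exact: h. Qed.
Let phibr x y : M x -> M y -> phi (br x y) = br (phi x) (phi y).
Proof. by case: ve => _ _ _ _ h; exact: h. Qed.
Let Mbr x y : M x -> M y -> M (br x y).
Proof. by case: ve => -[_ h] _ _ _ _; exact: h. Qed.
Let MD x y : M x -> M y -> M (x + y). Proof. by case: subM => _ h _; exact: h. Qed.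
Let MZ a x : M x -> M (a *: x). Proof. by case: subM => _ _ h; exact: h. Qed.
Let Mp v : M (pi *: v). Proof. by case: (index_p_cyclic p_prime subM idx). Qed.
Let Mgen v w : ~ M v -> exists j, M (w - j *: v).
Proof. by case: (index_p_cyclic p_prime subM idx) => _ h _; exact: h. Qed.
Let Mproper : exists v, ~ M v.
Proof. by case: (index_p_cyclic p_prime subM idx). Qed.

(** A total map that takes the place of extending [phi] to the rational span; the price is the
    factor [p] in [psibr]. *)
Let psi v := phi (pi *: v).

Let psiD x y : psi (x + y) = psi x + psi y.
Proof. by rewrite /psi scalerDr phiD. Qed.
Let psiZ a x : psi (a *: x) = a *: psi x.
Proof. by rewrite /psi scalerA mulrC -scalerA phiZ. Qed.
Let psi0 : psi 0 = 0. Proof. by have := psiZ 0 0; rewrite !scale0r. Qed.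
Let psi_comb (e0 e1 e2 : V) a b c : psi (comb e0 e1 e2 a b c) = comb (psi e0) (psi e1) (psi e2) a b c.
Proof. by rewrite /comb !psiD !psiZ. Qed.
Let psibr x y : pi *: psi (br x y) = br (psi x) (psi y).
Proof.
by rewrite /psi -phibr // (brZl Hlie) (brZr Hlie) -phiZ.
Qed.
Let psi_phi x : M x -> psi x = pi *: phi x. Proof. exact: phiZ. Qed.

Let pi_neq0 : pi <> 0.
Proof.
move=> e; apply: (is_unit_neq0 p_prime (x := 1)); first by exists 1; rewrite mulr1.
by apply: (@pmul_eq0 _ p_prime); rewrite e mul0r.
Qed.

Section Frame.
Variables (e0 e1 e2 : V) (fr : frame e0 e1 e2).

Let scaleV_inj (a : R) (v w : V) : a <> 0 -> a *: v = a *: w -> v = w.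
Proof.
move=> na; have [sp _] := fr.
have [x [y [z ->]]] := sp v; have [x' [y' [z' ->]]] := sp w.
rewrite !combZ => /(frame_inj fr) [h1 h2 h3].
by rewrite (padic_mulI p_prime na h1) (padic_mulI p_prime na h2) (padic_mulI p_prime na h3).
Qed.

Lemma psi_inj v : psi v = 0 -> v = 0.
Proof.
move=> h.
have : pi *: v = 0.
  apply: (simp (I := fun w => exists2 v', psi v' = 0 & w = pi *: v')); last by exists v.
  split.
  - split.
      split; first by exists 0; rewrite ?scaler0 ?psi0.
        move=> _ _ [x hx ->] [y hy ->]; exists (x + y); rewrite ?scalerDr //.
        by rewrite psiD hx hy addr0.
      move=> a _ [x hx ->]; exists (a *: x); first by rewrite psiZ hx scaler0.
      by rewrite !scalerA mulrC.
    move=> x _ [y hy ->]; exists (br x y); last by rewrite (brZr Hlie).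
    by apply: (scaleV_inj pi_neq0); rewrite psibr hy (br0r Hlie) scaler0.
  - by move=> _ [x _ ->].
  - by move=> _ [x hx ->]; exists 0; rewrite ?scaler0 // -(scale0r 0) psiZ scale0r.
by move=> h'; apply: (scaleV_inj pi_neq0); rewrite h' scaler0.
Qed.

(** The hypothesis excludes nilpotent [A]. The row [(l, m)] of [e0]-components of [psi e1], [psi e2]
    satisfies [(l, m) A = 0], hence is zero when [det A] is not. When [det A = 0], a non-zero row
    would force the columns of [A] into the kernel of [psi]. Once [<e1, e2>] is preserved, comparing
    traces and determinants fixes the factor. *)
Lemma psi_semi a11 a21 a12 a22 : semi br e0 e1 e2 a11 a21 a12 a22 ->
  a11 + a22 <> 0 \/ a11 * a22 - a12 * a21 <> 0 ->
  exists b11 b21 b12 b22, [/\ psi e1 = comb e0 e1 e2 0 b11 b21,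
    psi e2 = comb e0 e1 e2 0 b12 b22 &
    exists u, [/\ u = 1 \/ (u = -1 /\ a11 + a22 = 0),
      b11 * a11 + b12 * a21 = u * (a11 * b11 + a12 * b21),
      b21 * a11 + b22 * a21 = u * (a21 * b11 + a22 * b21),
      b11 * a12 + b12 * a22 = u * (a11 * b12 + a12 * b22) &
      b21 * a12 + b22 * a22 = u * (a21 * b12 + a22 * b22)]].
Proof.
move=> S nn; have [_ h12 h01 h02] := S; have [sp inj] := fr.
have [u [s [t p0]]] := sp (psi e0).
have [l [b11 [b21 p1]]] := sp (psi e1).
have [m [b12 [b22 p2]]] := sp (psi e2).
have sbr := semi_br Hlie _ _ _ _ _ _ S.
have := psibr e0 e1; rewrite h01 psi_comb p0 p1 p2 comb_comb sbr combZ => /(frame_inj fr) [A0 A1 A2].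
have := psibr e0 e2; rewrite h02 psi_comb p0 p1 p2 comb_comb sbr combZ => /(frame_inj fr) [B0 B1 B2].
have {}A0 : l * a11 + m * a21 = 0 by apply: (pmul_eq0 p_prime); rewrite -A0; ring.
have {}B0 : l * a12 + m * a22 = 0 by apply: (pmul_eq0 p_prime); rewrite -B0; ring.
have [l0 m0] : l = 0 /\ m = 0.
  apply: contrapT => nlm.
  have dA : a11 * a22 - a12 * a21 = 0.
    apply: contrapT => nd; apply: nlm; split; apply: (padic_mul_eq0 p_prime _ nd).
      transitivity (a22 * (l * a11 + m * a21) - a21 * (l * a12 + m * a22)); first by ring.
      by rewrite A0 B0; ring.
    transitivity (a11 * (l * a12 + m * a22) - a12 * (l * a11 + m * a21)); first by ring.
    by rewrite A0 B0; ring.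
  have ntr : a11 + a22 <> 0 by case: nn.
  (* an eigenvector x = comb 0 x1 x2 for the trace is killed by psi *)
  have K x1 x2 : a11 * x1 + a12 * x2 = (a11 + a22) * x1 ->
      a21 * x1 + a22 * x2 = (a11 + a22) * x2 -> l * x1 + m * x2 = 0 -> x1 = 0 /\ x2 = 0.
    move=> k1 k2 k3.
    suff /psi_inj/inj [] : psi (comb e0 e1 e2 0 x1 x2) = 0 by [].
    have [y0 [y1 [y2 py]]] := sp (psi (comb e0 e1 e2 0 x1 x2)).
    have y00 : y0 = 0.
      move: py; rewrite psi_comb p0 p1 p2 comb_comb => /(frame_inj fr) [<- _ _].
      by rewrite -[RHS]k3; ring.
    rewrite {}y00 in py.
    have z1 : br e1 (comb e0 e1 e2 0 x1 x2) = 0.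
      by rewrite -{1}(comb010 e0 e1 e2) sbr -[RHS](comb000 e0 e1 e2); congr comb; ring.
    have z2 : br e2 (comb e0 e1 e2 0 x1 x2) = 0.
      by rewrite -{1}(comb001 e0 e1 e2) sbr -[RHS](comb000 e0 e1 e2); congr comb; ring.
    have := psibr e1 (comb e0 e1 e2 0 x1 x2).
    rewrite z1 psi0 scaler0 p1 py sbr => /esym/inj [_ r1 r2].
    have := psibr e2 (comb e0 e1 e2 0 x1 x2).
    rewrite z2 psi0 scaler0 p2 py sbr => /esym/inj [_ r3 r4].
    have [q1 q2] : a11 * y1 + a12 * y2 = 0 /\ a21 * y1 + a22 * y2 = 0.
      case: (pselect (l = 0)) => [el|nl].
        have nm : m <> 0 by move=> em; apply: nlm.
        split; apply: (padic_mul_eq0 p_prime _ nm).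
          by rewrite -[RHS]r3; ring.
        by rewrite -[RHS]r4; ring.
      split; apply: (padic_mul_eq0 p_prime _ nl).
        by rewrite -[RHS]r1; ring.
      by rewrite -[RHS]r2; ring.
    have z0 : br e0 (comb e0 e1 e2 0 x1 x2) = (a11 + a22) *: comb e0 e1 e2 0 x1 x2.
      rewrite -{1}(comb100 e0 e1 e2) sbr combZ -k1 -k2; congr comb; ring.
    have := psibr e0 (comb e0 e1 e2 0 x1 x2).
    rewrite z0 psiZ py p0 sbr !combZ q1 q2 => /(frame_inj fr) [_ w1 w2].
    rewrite -(comb000 e0 e1 e2); congr comb; apply: (padic_mul_eq0 p_prime _ ntr);
      apply: (pmul_eq0 p_prime).
      by rewrite w1; ring.
    by rewrite w2; ring.
  (* For [det A = 0], Cayley-Hamilton gives [A^2 = (tr A) A]: the columns of [A] are eigenvectors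
     for the trace, and [(l, m)] annihilates them. *)
  have [a11z a21z] : a11 = 0 /\ a21 = 0.
    apply: K => //; apply: subr0_eq.
      by transitivity (- (a11 * a22 - a12 * a21)); [ring|rewrite dA oppr0].
    by ring.
  have [a12z a22z] : a12 = 0 /\ a22 = 0.
    apply: K => //; apply: subr0_eq.
      by ring.
    by transitivity (- (a11 * a22 - a12 * a21)); [ring|rewrite dA oppr0].
  by apply: ntr; rewrite a11z a22z addr0.
subst l m.
exists b11, b21, b12, b22; split=> //.
have nD : b11 * b22 - b12 * b21 <> 0.
  move=> D0.
  have /psi_inj/inj [_ z22 z21] : psi (comb e0 e1 e2 0 b22 (- b21)) = 0.
    rewrite psi_comb p0 p1 p2 comb_comb -(comb000 e0 e1 e2); congr comb; last by ring.
      by ring.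
    by rewrite -[RHS]D0; ring.
  have /psi_inj/inj [_ z12 z11] : psi (comb e0 e1 e2 0 b12 (- b11)) = 0.
    rewrite psi_comb p0 p1 p2 comb_comb -(comb000 e0 e1 e2); congr comb; first by ring.
      by ring.
    by rewrite -[RHS]oppr0 -[in RHS]D0; ring.
  have : e1 = 0.
    apply: psi_inj; rewrite p1 -(comb000 e0 e1 e2); congr comb; apply: oppr_inj; rewrite oppr0 //.
  rewrite -(comb010 e0 e1 e2) => /inj [_ /(is_unit_neq0 p_prime) h _]; apply: h.
  by exists 1; rewrite mulr1.
have E11 : pi * (b11 * a11 + b12 * a21) = u * (a11 * b11 + a12 * b21) by move: A1; rewrite !mul0r !add0r !subr0 => <-; ring.
have E21 : pi * (b21 * a11 + b22 * a21) = u * (a21 * b11 + a22 * b21) by move: A2; rewrite !mul0r !add0r !subr0 => <-; ring.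
have E12 : pi * (b11 * a12 + b12 * a22) = u * (a11 * b12 + a12 * b22) by move: B1; rewrite !mul0r !add0r !subr0 => <-; ring.
have E22 : pi * (b21 * a12 + b22 * a22) = u * (a21 * b12 + a22 * b22) by move: B2; rewrite !mul0r !add0r !subr0 => <-; ring.
(* Since [det B] is non-zero, [p A] and [u A] are conjugate over the fraction field. The combination
   is the adjugate of [B] contracted with the four entries. *)
have tr : (pi - u) * (a11 + a22) = 0.
  apply: (padic_mul_eq0 p_prime _ nD).
  transitivity (b22 * (pi * (b11 * a11 + b12 * a21) - u * (a11 * b11 + a12 * b21))
    - b21 * (pi * (b11 * a12 + b12 * a22) - u * (a11 * b12 + a12 * b22))
    - b12 * (pi * (b21 * a11 + b22 * a21) - u * (a21 * b11 + a22 * b21))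
    + b11 * (pi * (b21 * a12 + b22 * a22) - u * (a21 * b12 + a22 * b22))); first by ring.
  by rewrite E11 E12 E21 E22; ring.
have dt : (pi ^+ 2 - u ^+ 2) * (a11 * a22 - a12 * a21) = 0.
  apply: (padic_mul_eq0 p_prime _ nD).
  transitivity ((pi * (b11 * a11 + b12 * a21)) * (pi * (b21 * a12 + b22 * a22))
    - (pi * (b11 * a12 + b12 * a22)) * (pi * (b21 * a11 + b22 * a21))
    - u ^+ 2 * ((a11 * b11 + a12 * b21) * (a21 * b12 + a22 * b22) - (a11 * b12 + a12 * b22) * (a21 * b11 + a22 * b21))); first by ring.
  by rewrite E11 E12 E21 E22; ring.
have [eu|[ntu eu]] : u = pi \/ (a11 + a22 = 0 /\ u = - pi).
  case: (pselect (a11 + a22 = 0)) => [tr0|ntr]; last first.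
    by left; apply/esym/subr0_eq; apply: (padic_mul_eq0 p_prime _ ntr); rewrite mulrC.
  have nd : a11 * a22 - a12 * a21 <> 0 by case: nn.
  have e : (pi - u) * (pi + u) = 0.
    by apply: (padic_mul_eq0 p_prime _ nd); rewrite -dt; ring.
  case: (pselect (pi - u = 0)) => [/subr0_eq ->|n1]; first by left.
  right; split=> //; have := padic_mul_eq0 p_prime e n1.
  by move/eqP; rewrite addrC addr_eq0 => /eqP.
- exists 1; split; [by left|..]; apply: (pmul_inj p_prime).
  + by rewrite E11 eu; ring.
  + by rewrite E21 eu; ring.
  + by rewrite E12 eu; ring.
  + by rewrite E22 eu; ring.
- exists (-1); split; [by right|..]; apply: (pmul_inj p_prime).
  + by rewrite E11 eu; ring.
  + by rewrite E21 eu; ring.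
  + by rewrite E12 eu; ring.
  + by rewrite E22 eu; ring.
Qed.

Lemma ideal_not_in_domain a11 a21 a12 a22 : semi br e0 e1 e2 a11 a21 a12 a22 ->
  a11 + a22 <> 0 \/ a11 * a22 - a12 * a21 <> 0 -> ~ (M e1 /\ M e2).
Proof.
move=> S nn [M1 M2]; have [b11 [b21 [b12 [b22 [p1 p2 _]]]]] := psi_semi S nn.
have [sp inj] := fr.
have Nphi v : M v -> (exists x y, psi v = comb e0 e1 e2 0 x y) ->
    exists x y, phi v = comb e0 e1 e2 0 x y.
  move=> Mv [x [y e]]; have [x0 [y0 [z0 e']]] := sp (phi v).
  exists y0, z0; rewrite e'; move: e; rewrite psi_phi // e' combZ => /(frame_inj fr) [h _ _].
  by rewrite (pmul_eq0 p_prime h).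
have : e1 = 0.
  apply: (simp (I := fun v => exists x y, v = comb e0 e1 e2 0 x y)); last by exists 1, 0; rewrite comb010.
  split.
  - split.
      split; first by exists 0, 0; rewrite comb000.
        by move=> _ _ [x [y ->]] [x' [y' ->]]; exists (x + x'), (y + y'); rewrite combD addr0.
      by move=> a _ [x [y ->]]; exists (a * x), (a * y); rewrite combZ mulr0.
    move=> v _ [x [y ->]]; have [a [b [c ->]]] := sp v.
    rewrite (semi_br Hlie _ _ _ _ _ _ S); eexists _, _; reflexivity.
  - move=> _ [x [y ->]]; rewrite /comb; apply: MD; last exact: MZ.
    by apply: MD; [rewrite scale0r -(scale0r e1)|]; apply: MZ.
  - move=> _ [x [y ->]]; apply: Nphi.
      rewrite /comb; apply: MD; last exact: MZ.
      by apply: MD; [rewrite scale0r -(scale0r e1)|]; apply: MZ.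
    have [a [b [c e0']]] := sp (psi e0).
    by rewrite psi_comb p1 p2 e0' comb_comb !mul0r !mulr0 !add0r; eexists _, _; reflexivity.
rewrite -(comb010 e0 e1 e2) => /inj [_ /(is_unit_neq0 p_prime) h _]; apply: h.
by exists 1; rewrite mulr1.
Qed.

Lemma M_comb a b d : M e0 -> M e1 -> M (comb e0 e1 e2 a b (pi * d)).
Proof.
move=> M0 M1; apply: MD; first by apply: MD; apply: MZ.
by rewrite mulrC -scalerA; apply: MZ.
Qed.

(** [J] describes an ideal inside [<e1, e2>] by coordinates: stable under [A], contained in
    [<e1, p e2>], stable under [phi]. Each contradiction below comes from one choice of [J]. *)
Lemma no_invariant a11 a21 a12 a22 b11 b21 b12 b22 (J : R -> R -> Prop) :
  semi br e0 e1 e2 a11 a21 a12 a22 -> M e0 -> M e1 ->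
  phi e1 = comb e0 e1 e2 0 b11 b21 -> psi e2 = comb e0 e1 e2 0 b12 b22 ->
  J 0 0 -> (forall x y x' y', J x y -> J x' y' -> J (x + x') (y + y')) ->
  (forall a x y, J x y -> J (a * x) (a * y)) ->
  (forall x y, J x y -> J (a11 * x + a12 * y) (a21 * x + a22 * y)) ->
  (forall x y, J x y -> exists y', y = pi * y' /\ J (x * b11 + y' * b12) (x * b21 + y' * b22)) ->
  forall x y, J x y -> x = 0 /\ y = 0.
Proof.
move=> S M0 M1 p1 p2 J0 JD JZ JA Jphi x y Jxy; have [sp inj] := fr.
have MJ x' y' : J x' y' -> M (comb e0 e1 e2 0 x' y').
  by move=> /Jphi [z [-> _]]; apply: M_comb.
suff /inj [] : comb e0 e1 e2 0 x y = 0 by [].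
apply: (simp (I := fun v => exists x y, J x y /\ v = comb e0 e1 e2 0 x y)); last by exists x, y.
split.
- split.
    split; first by exists 0, 0; rewrite comb000.
      move=> _ _ [x' [y' [h ->]]] [x2 [y2 [h2 ->]]].
      by exists (x' + x2), (y' + y2); rewrite combD addr0; split=> //; apply: JD.
    move=> a _ [x' [y' [h ->]]].
    by exists (a * x'), (a * y'); rewrite combZ mulr0; split=> //; apply: JZ.
  move=> v _ [x' [y' [h ->]]]; have [a [b [c ->]]] := sp v.
  exists (a * (a11 * x' + a12 * y')), (a * (a21 * x' + a22 * y')); split; first by apply: JZ; apply: JA.
  by rewrite (semi_br Hlie _ _ _ _ _ _ S); congr comb; ring.
- by move=> _ [x' [y' [h ->]]]; apply: MJ.
- move=> _ [x' [y' [h ->]]]; have [z [ez h']] := Jphi _ _ h.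
  exists (x' * b11 + z * b12), (x' * b21 + z * b22); split=> //.
  have -> : comb e0 e1 e2 0 x' y' = x' *: e1 + z *: (pi *: e2).
    by rewrite /comb scale0r add0r ez scalerA mulrC.
  rewrite phiD; [|exact: MZ|exact: MZ].
  rewrite phiZ // phiZ // -/(psi e2) p1 p2 !combZ combD.
  by congr comb; ring.
Qed.

End Frame.

(** Here [M = <e0, e1, p e2>]. Relative to this basis the matrix of [psi] has first column divisible
    by [p], so reduction modulo [p] of its relation with [C] carries all the information. *)
Lemma adapted_obstruction e0 e1 e2 a k c11 c12 c21 :
  semi br e0 e1 e2 (a + pi ^+ k * c11) (pi ^+ k * c21) (pi ^+ k * c12) (a - pi ^+ k * c11) ->
  [\/ is_unit c11, is_unit c12 | is_unit c21] ->
  a <> 0 \/ c11 ^+ 2 + c12 * c21 <> 0 ->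
  M e0 -> M e1 -> ~ M e2 ->
  (exists d, is_unit d /\ c11 ^+ 2 + c12 * c21 = pi * d) \/
  (a = 0 /\ exists g, is_unit g /\ c11 ^+ 2 + c12 * c21 = g ^+ 2).
Proof.
move=> S prim nn M0 M1 nM2; have [fr _ h01 _] := S; have [sp inj] := fr.
have u2 := two_unit p_prime p_ge3; have n2 := is_unit_neq0 p_prime u2.
(* [M] is a subalgebra containing [e0] and [e1] but no unit multiple of [e2] modulo [e1]. *)
have hA21 : pdvd (pi ^+ k * c21).
  case: (unit_or_pdvd p_prime (pi ^+ k * c21)) => // -[i hi]; case: nM2.
  have h : M ((pi ^+ k * c21) *: e2).
    have := submoduleB subM (Mbr M0 M1) (MZ (a + pi ^+ k * c11) M1).
    rewrite h01 /comb scale0r add0r addrAC subrr add0r //.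
  by have := MZ i h; rewrite scalerA mulrC hi scale1r.
have c_unit21 : pdvd c21 -> pdvd c11 -> is_unit c12.
  by move=> h1 h2; case: prim => // h; [case: (unit_pdvdF p_prime h h2)|case: (unit_pdvdF p_prime h h1)].
have vp1 d : pdvd c11 -> is_unit c12 -> is_unit d -> c21 = pi * d ->
    exists d, is_unit d /\ c11 ^+ 2 + c12 * c21 = pi * d.
  move=> [x ex] u12 ud e; exists (c12 * d + pi * x ^+ 2); split.
    by apply: is_unit_pdvdD => //; [apply: is_unitM|exists (x ^+ 2)].
  by rewrite ex e; ring.
have [b11' [b21' [b12 [b22 [p1 p2 [u [hu E11 E21 E12 E22]]]]]]] : exists b11 b21 b12 b22,
    [/\ psi e1 = comb e0 e1 e2 0 b11 b21, psi e2 = comb e0 e1 e2 0 b12 b22 &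
    exists u, [/\ u = 1 \/ (u = -1 /\ a = 0),
      b11 * c11 + b12 * c21 = u * (c11 * b11 + c12 * b21),
      b21 * c11 + b22 * c21 = u * (c21 * b11 - c11 * b21),
      b11 * c12 - b12 * c11 = u * (c11 * b12 + c12 * b22) &
      b21 * c12 - b22 * c11 = u * (c21 * b12 - c11 * b22)]].
  have [|b11 [b21 [b12 [b22 [p1 p2 [u [hu E11 E21 E12 E22]]]]]]] := psi_semi fr S.
    case: (pselect (a = 0)) => [a0|na].
      have nc : c11 ^+ 2 + c12 * c21 <> 0 by case: nn.
      right=> e; apply: nc; apply: (@pexp_mul_eq0 _ p_prime k); apply: (@pexp_mul_eq0 _ p_prime k).
      apply: oppr_inj; rewrite oppr0 -[RHS]e a0; move: (pi ^+ k) => q; ring.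
    left=> e; apply: na; apply: (padic_mul_eq0 p_prime _ n2); rewrite -[RHS]e; move: (pi ^+ k) => q; ring.
  have ha : u = 1 \/ (u = -1 /\ a = 0).
    case: hu => [->|[-> e]]; [by left|right; split=> //].
    by apply: (padic_mul_eq0 p_prime _ n2); rewrite -[RHS]e; move: (pi ^+ k) => q; ring.
  (* This removes the scalar part from the relation, which can then be divided by [p^k]. *)
  have au : (1 - u) * a = 0 by case: ha => [->|[_ ->]]; rewrite ?mulr0 // subrr mul0r.
  exists b11, b21, b12, b22; split=> //; exists u; split=> //;
    apply: (@pexp_inj _ p_prime k); apply: subr0_eq.
  - transitivity ((b11 * (a + pi ^+ k * c11) + b12 * (pi ^+ k * c21)) - u * ((a + pi ^+ k * c11) * b11 + pi ^+ k * c12 * b21) - b11 * ((1 - u) * a)).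
      by move: (pi ^+ k) => q; ring.
    by rewrite E11 au; ring.
  - transitivity ((b21 * (a + pi ^+ k * c11) + b22 * (pi ^+ k * c21)) - u * (pi ^+ k * c21 * b11 + (a - pi ^+ k * c11) * b21) - b21 * ((1 - u) * a)).
      by move: (pi ^+ k) => q; ring.
    by rewrite E21 au; ring.
  - transitivity ((b11 * (pi ^+ k * c12) + b12 * (a - pi ^+ k * c11)) - u * ((a + pi ^+ k * c11) * b12 + pi ^+ k * c12 * b22) - b12 * ((1 - u) * a)).
      by move: (pi ^+ k) => q; ring.
    by rewrite E12 au; ring.
  - transitivity ((b21 * (pi ^+ k * c12) + b22 * (a - pi ^+ k * c11)) - u * (pi ^+ k * c21 * b12 + (a - pi ^+ k * c11) * b22) - b22 * ((1 - u) * a)).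
      by move: (pi ^+ k) => q; ring.
    by rewrite E22 au; ring.
have [b0 [b11 [b21 q1]]] := sp (phi e1).
have := p1; rewrite psi_phi // q1 combZ => /(frame_inj fr) [/(pmul_eq0 p_prime) b00 eb11 eb21].
rewrite {}b00 in q1; subst b11' b21'.
have noJ J := no_invariant (J := J) fr S M0 M1 q1 p2.
have no_pN : pdvd b12 -> pdvd b22 -> False.
  move=> [x12 x12E] [x22 x22E].
  (* The ideal [<p e1, p e2>]. *)
  have [||||||e _] := noJ (fun x y => pdvd x /\ pdvd y) _ _ _ _ _ pi 0; last exact: pi_neq0.
  - by split; exact: pdvd0.
  - by move=> x y x' y' [? ?] [? ?]; split; apply: pdvdD.
  - by move=> r x y [? ?]; split; apply: pdvdMl.
  - by move=> x y [? ?]; split; apply: pdvdD; apply: pdvdMl.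
  - move=> x y [hx [y' ->]]; exists y'; split=> //; rewrite x12E x22E.
    split; apply: pdvdD; [exact: pdvdMr|apply: pdvdMl; exact: pdvdp|exact: pdvdMr|apply: pdvdMl; exact: pdvdp].
  - by split; [exists 1; rewrite mulr1|exact: pdvd0].
have no_N1 : pdvd b21 -> pdvd b22 -> False.
  move=> h21 h22.
  (* The ideal [<e1, p e2>], stable under [A] because [p] divides its lower left entry. *)
  have [||||||e _] := noJ (fun x y => pdvd y) _ _ _ _ _ pi 0; last exact: pi_neq0.
  - exact: pdvd0.
  - by move=> x y x' y' ? ?; apply: pdvdD.
  - by move=> r x y ?; apply: pdvdMl.
  - by move=> x y ?; apply: pdvdD; [apply: pdvdMr|apply: pdvdMl].
  - by move=> x y [y' ->]; exists y'; split=> //; apply: pdvdD; apply: pdvdMl.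
  - exact: pdvd0.
case: hu => [eu|[eu a0]]; subst u.
- pose d := pi * b11 - b22; have [h hh] := u2; pose t := h * d.
  have ht : 2%:R * t = d by rewrite /t mulrA hh mul1r.
  (* The traceless part of the matrix of [psi] commutes with [C], hence equals [be C]. If [p]
     divided [be], the ideal [<p e1, p e2>] would be invariant. *)
  have [be [et e12 e21]] : exists be, [/\ t = be * c11, b12 = be * c12 & pi * b21 = be * c21].
    have F1 : c12 * t = c11 * b12.
      apply: (unit_mul_inj u2); rewrite mulrCA ht /d; apply: subr0_eq.
      transitivity ((pi * b11 * c12 - b12 * c11) - 1 * (c11 * b12 + c12 * b22)); first by ring.
      by rewrite E12 subrr.
    have F2 : c21 * t = c11 * (pi * b21).
      apply: (unit_mul_inj u2); rewrite mulrCA ht /d; apply: subr0_eq.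
      transitivity (- ((pi * b21 * c11 + b22 * c21) - 1 * (c21 * (pi * b11) - c11 * (pi * b21)))); first by ring.
      by rewrite E21 subrr oppr0.
    have F3 : c21 * b12 = c12 * (pi * b21).
      apply: subr0_eq.
      transitivity ((pi * b11 * c11 + b12 * c21) - 1 * (c11 * (pi * b11) + c12 * (pi * b21))); first by ring.
      by rewrite E11 subrr.
    exact: parallel3 F1 F2 F3 prim.
  have eb22 : b22 = pi * b11 - 2%:R * (be * c11) by rewrite -et ht /d; ring.
  case: (unit_or_pdvd p_prime be) => hbe; last first.
    exfalso; apply: no_pN; first by rewrite e12; apply: pdvdMr.
    by rewrite eb22; apply: pdvdB; [exact: pdvdp|apply: pdvdMl; apply: pdvdMr].
  have hc21 : pdvd c21 by apply: (pdvd_mul_unit p_prime hbe); exists b21.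
  have [c c21E] := hc21.
  case: (unit_or_pdvd p_prime c11) => u11.
    exfalso.
    (* A root [g] congruent to [c11] has the eigenvector [(c11 + g, c21)], primitive and inside
       [<e1, p e2>]. There [psi] acts by [p b11 + be (g - c11)], a multiple of [p], so [phi]
       preserves this eigenline. *)
    have [||g [g2 [g' eg']]] := hensel_sqrt p_prime (d := c11 ^+ 2 + c12 * c21) (c := c11).
    + exact: is_unitM.
    + by rewrite addrC addKr; apply: pdvdMl.
    have cg : is_unit (c11 + g).
      have -> : c11 + g = 2%:R * c11 + pi * g' by rewrite -eg'; ring.
      by apply: is_unit_pdvdD => //; [exact: is_unitM|exact: pdvdp].
    have eg : g = c11 + pi * g' by rewrite -eg'; ring.
    have [||||||e _] := noJ (fun x y => exists r, x = r * (c11 + g) /\ y = r * c21) _ _ _ _ _ (c11 + g) c21;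
      last exact: (is_unit_neq0 p_prime cg).
    + by exists 0; rewrite !mul0r.
    + by move=> x y x' y' [r [-> ->]] [r' [-> ->]]; exists (r + r'); rewrite !mulrDl.
    + by move=> s x y [r [-> ->]]; exists (s * r); rewrite !mulrA.
    + move=> x y [r [-> ->]]; exists (r * (a + pi ^+ k * g)); move: (pi ^+ k) => q; split; last by ring.
      apply: subr0_eq; transitivity (r * q * (c11 ^+ 2 + c12 * c21 - g ^+ 2)); first by ring.
      by rewrite g2 subrr mulr0.
    + move=> x y [r [-> ->]]; exists (r * c); split; first by rewrite c21E; ring.
      exists (r * (b11 + be * g')); split; apply: (pmul_inj p_prime); apply: subr0_eq.
        transitivity (r * be * (c11 ^+ 2 + c12 * (pi * c) - g ^+ 2)).
          by rewrite e12 eg; ring.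
        by rewrite -c21E g2 subrr mulr0.
      transitivity (r * ((c11 + g) * (pi * b21) + (pi * c) * b22 - pi * (b11 + be * g') * c21)); first by ring.
      by rewrite e21 -c21E eb22 eg; ring.
    + by exists 1; rewrite !mul1r.
  have u12 := c_unit21 hc21 u11.
  left; apply: (vp1 c) => //.
  case: (unit_or_pdvd p_prime c) => // hc; exfalso; apply: no_N1.
    have -> : b21 = be * c by apply: (pmul_inj p_prime); rewrite e21 c21E; ring.
    exact: pdvdMl.
  by rewrite eb22; apply: pdvdB; [exact: pdvdp|apply: pdvdMl; apply: pdvdMl].
- have E1 : 2%:R * (pi * b11 * c11) + b12 * c21 + pi * b21 * c12 = 0.
    apply: subr0_eq.
    transitivity ((pi * b11 * c11 + b12 * c21) - -1 * (c11 * (pi * b11) + c12 * (pi * b21))); first by ring.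
    by rewrite E11 subrr.
  have eb22 : b22 = - (pi * b11).
    apply/eqP; rewrite -addr_eq0; apply/eqP.
    case: prim => hc.
    + apply: (padic_mul_eq0 p_prime _ (is_unit_neq0 p_prime (is_unitM u2 hc))).
      transitivity ((2%:R * (pi * b11 * c11) + b12 * c21 + pi * b21 * c12) - ((pi * b21 * c12 - b22 * c11) - -1 * (c21 * b12 - c11 * b22))); first by ring.
      by rewrite E1 E22 subrr subr0.
    + apply: (padic_mul_eq0 p_prime _ (is_unit_neq0 p_prime hc)).
      transitivity ((pi * b11 * c12 - b12 * c11) - -1 * (c11 * b12 + c12 * b22)); first by ring.
      by rewrite E12 subrr.
    + apply: (padic_mul_eq0 p_prime _ (is_unit_neq0 p_prime hc)).
      transitivity ((pi * b21 * c11 + b22 * c21) - -1 * (c21 * (pi * b11) - c11 * (pi * b21))); first by ring.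
      by rewrite E21 subrr.
  have h22 : pdvd b22 by rewrite eb22; apply: pdvdN; exact: pdvdp.
  case: (unit_or_pdvd p_prime b12) => [u12|h]; last by case: (no_pN h h22).
  case: (unit_or_pdvd p_prime b21) => [u21|h]; last by case: (no_N1 h h22).
  have hc21 : pdvd c21.
    apply: (pdvd_mul_unit p_prime u12); exists (- (2%:R * b11 * c11 + b21 * c12)).
    apply: subr0_eq; rewrite -[RHS]E1; ring.
  have [c c21E] := hc21.
  case: (unit_or_pdvd p_prime c11) => u11.
    right; split=> //.
    have [||g [g2 [g' eg']]] := hensel_sqrt p_prime (d := c11 ^+ 2 + c12 * c21) (c := c11).
    + exact: is_unitM.
    + by rewrite addrC addKr; apply: pdvdMl.
    exists g; split=> //.
    have -> : g = c11 + pi * g' by rewrite -eg'; ring.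
    by apply: is_unit_pdvdD => //; exact: pdvdp.
  have uc12 := c_unit21 hc21 u11.
  left; apply: (vp1 c) => //.
  apply: (is_unitMr (x := b12)).
  have -> : b12 * c = - (b21 * c12 + 2%:R * b11 * c11).
    apply: (pmul_inj p_prime); apply: subr0_eq; rewrite -[RHS]E1 c21E; ring.
  by apply: is_unitN; apply: is_unit_pdvdD => //; [exact: is_unitM|exact: pdvdMl].
Qed.

(** The abelian ideal is not canonical here, but the centre, the line of [e1], contains all
    brackets. Writing a multiple of [e1] as a bracket of elements of [M] shows that [phi] preserves
    the line where it is defined, so [e1] or [p e1] spans an invariant ideal. *)
Lemma heisenberg_obstruction e0 e1 e2 q : semi br e0 e1 e2 0 0 q 0 -> q <> 0 -> False.
Proof.
move=> S0 nq.
have scale_inj (f0 f1 f2 : V) : frame f0 f1 f2 -> forall (r : R) a b c w,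
    r <> 0 -> r *: w = comb f0 f1 f2 (r * a) (r * b) (r * c) -> w = comb f0 f1 f2 a b c.
  move=> fr r a b c w nr; have [sp _] := fr; have [x [y [z ->]]] := sp w.
  rewrite combZ => /(frame_inj fr) [/(padic_mulI p_prime nr) -> /(padic_mulI p_prime nr) -> ].
  by move=> /(padic_mulI p_prime nr) ->.
have line f0 f1 f2 r m z : semi br f0 f1 f2 0 0 r 0 -> m <> 0 -> M (m *: f1) ->
    phi (m *: f1) = z *: (m *: f1) -> False.
  move=> S nm Mm e; have [fr _ _ _] := S; have [sp inj] := fr.
  have : m *: f1 = 0.
    apply: (simp (I := fun v => exists t, v = t *: (m *: f1))); last by exists 1; rewrite scale1r.
    split.
    - split.
        split; first by exists 0; rewrite scale0r.
          by move=> _ _ [t ->] [t' ->]; exists (t + t'); rewrite scalerDl.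
        by move=> a _ [t ->]; exists (a * t); rewrite scalerA.
      move=> v _ [t ->]; exists 0; have [a [b [c ->]]] := sp v.
      rewrite scale0r -[X in br _ (_ *: (_ *: X))](comb010 f0 f1 f2) !combZ.
      by rewrite (semi_br Hlie _ _ _ _ _ _ S) -[RHS](comb000 f0 f1 f2); congr comb; ring.
    - by move=> _ [t ->]; apply: MZ.
    - by move=> _ [t ->]; exists (t * z); rewrite phiZ // e scalerA.
  rewrite -(comb010 f0 f1 f2) combZ => /inj [_ h _]; apply: nm.
  by rewrite -h mulr1.
have central f0 f1 f2 r : semi br f0 f1 f2 0 0 r 0 -> r <> 0 -> M f1 -> ~ M f2 -> False.
  move=> S nr M1 nM2; have [fr _ _ h02] := S; have [sp inj] := fr.
  have [j hj] := Mgen f0 nM2.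
  have [a [b [c ea]]] := sp (phi (f0 - j *: f2)); have [a' [b' [c' ea']]] := sp (psi f2).
  have E : phi (br (f0 - j *: f2) (pi *: f2)) = br (comb f0 f1 f2 a b c) (comb f0 f1 f2 a' b' c').
    by rewrite phibr // ea -ea'.
  have E1 : br (f0 - j *: f2) (pi *: f2) = (r * pi) *: f1.
    rewrite -scaleNr (brDl Hlie) !(brZr Hlie) (brZl Hlie) (brxx Hlie) h02 !scaler0 addr0.
    by rewrite /comb !scale0r add0r addr0 scalerA mulrC.
  rewrite E1 (semi_br Hlie _ _ _ _ _ _ S) -scalerA phiZ // in E.
  have {E} E2 : phi (pi *: f1) = comb f0 f1 f2 0 (a * c' - a' * c) 0.
    by apply: (scale_inj _ _ _ fr r) => //; rewrite E; congr comb; ring.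
  have [x [y [z ez]]] := sp (phi f1).
  move: E2; rewrite phiZ // ez combZ => /(frame_inj fr) [x0 _ z0].
  apply: (line f0 f1 f2 r 1 y) => //.
  - by apply: (is_unit_neq0 p_prime); exists 1; rewrite mulr1.
  - exact: MZ.
  - rewrite !scale1r ez (pmul_eq0 p_prime x0) (pmul_eq0 p_prime z0).
    by rewrite /comb !scale0r add0r addr0.
have [fr h12 h01 h02] := S0; have [sp inj] := fr.
have h01' : br e0 e1 = 0 by rewrite h01 comb000.
case: (pselect (M e1)) => [M1|nM1].
  case: (pselect (M e2)) => [M2|]; last exact: (central _ _ _ _ S0).
  case: (pselect (M e0)) => [M0|nM0].
    have [v nv] := Mproper; apply: nv; have [a [b [c ->]]] := sp v.
    by apply: MD; [apply: MD|]; apply: MZ.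
  (* If [e1] and [e2] lie in [M], the missing vector is [e0]; exchanging [e0] and [e2] negates the
     bracket. *)
  apply: (central e2 e1 e0 (- q)) => //; last by move=> e; apply: nq; rewrite -(opprK q) e oppr0.
  split.
  - apply: (frame_subst fr (esym (comb001 e0 e1 e2)) (esym (comb010 e0 e1 e2)) (esym (comb100 e0 e1 e2))).
    by exists (-1); rewrite /det3; ring.
  - by rewrite (brC Hlie) h01' oppr0.
  - by rewrite comb000 (brC Hlie) h12 oppr0.
  - by rewrite (brC Hlie) h02 /comb !scale0r !add0r !addr0 scaleNr.
have [j hj] := Mgen e0 nM1; have [l hl] := Mgen e2 nM1.
have [a [b [c ea]]] := sp (phi (e0 - j *: e1)); have [a' [b' [c' ea']]] := sp (phi (e2 - l *: e1)).
have E1 : br (e0 - j *: e1) (e2 - l *: e1) = q *: e1.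
  rewrite -!scaleNr (brDl Hlie) !(brDr Hlie) !(brZr Hlie) !(brZl Hlie) (brxx Hlie) h01' h12 h02.
  by rewrite /comb !scaler0 !addr0 !scale0r add0r addr0.
have Mq : M (q *: e1) by rewrite -E1; apply: Mbr.
have E : phi (q *: e1) = comb e0 e1 e2 0 (q * (a * c' - a' * c)) 0.
  by rewrite -E1 phibr // ea ea' (semi_br Hlie _ _ _ _ _ _ S0); congr comb; ring.
apply: (line e0 e1 e2 q pi (a * c' - a' * c)) => //.
have -> : (a * c' - a' * c) *: (pi *: e1) = comb e0 e1 e2 0 (pi * (a * c' - a' * c)) 0.
  by rewrite /comb !scale0r add0r addr0 scalerA mulrC.
apply: (scale_inj _ _ _ fr q) => //.
by rewrite -phiZ // scalerA mulrC -scalerA phiZ // E combZ; congr comb; ring.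
Qed.

Lemma index_p_obstruction e0 e1 e2 a k c :
  semi br e0 e1 e2 a (pi ^+ k * c) (pi ^+ k) a ->
  (exists d, is_unit d /\ c = pi * d) \/ (a = 0 /\ exists g, is_unit g /\ c = g ^+ 2).
Proof.
move=> S; have [fr _ _ _] := S.
have one : is_unit (1 : R) by exists 1; rewrite mulr1.
have nq : pi ^+ k <> 0.
  move=> e; apply: (is_unit_neq0 p_prime one).
  by apply: (@pexp_mul_eq0 _ p_prime k); rewrite e mul0r.
case: (pselect (a = 0 /\ c = 0)) => [[a0 c0]|nac].
  by case: (@heisenberg_obstruction e0 e1 e2 (pi ^+ k)) => //; rewrite a0 c0 mulr0 in S.
have nn : a <> 0 \/ c <> 0.
  by case: (pselect (a = 0)) => [a0|]; [right=> c0; apply: nac|left].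
have nN : ~ (M e1 /\ M e2).
  apply: (ideal_not_in_domain fr S); case: (pselect (a = 0)) => [a0|na].
    right=> e; case: nn => // nc; apply: nc.
    apply: (padic_mul_eq0 p_prime _ nq); apply: (padic_mul_eq0 p_prime _ nq).
    by apply: oppr_inj; rewrite oppr0 -[RHS]e a0; move: (pi ^+ k) => q; ring.
  left=> e; apply: na; apply: (padic_mul_eq0 p_prime _ (is_unit_neq0 p_prime (two_unit p_prime p_ge3))).
  by rewrite -[RHS]e; ring.
case: (pselect (M e2)) => [M2|nM2].
  have nM1 : ~ M e1 by move=> M1; apply: nN.
  have [l hl] := Mgen e0 nM1.
  (* Exchanging [e1] and [e2] adapts the basis, with [c11 = 0], [c12 = c], [c21 = 1]. *)
  have E : 0 ^+ 2 + c * 1 = c :> R by ring.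
  rewrite -E; apply: (@adapted_obstruction (e0 - l *: e1) e2 e1 a k) => //.
  - apply: (semi_change Hlie S (k := 1) (s := - l) (t := 0) _ (esym (comb001 _ _ _)) (esym (comb010 _ _ _)));
      try (move: (pi ^+ k) => q; ring).
    + by rewrite /comb scale1r scale0r addr0 scaleNr.
    + by exists (-1); ring.
  - by constructor 3.
  - by rewrite E.
have [l hl] := Mgen e0 nM2; have [j hj] := Mgen e1 nM2.
(* Replacing [e1] by [e1 - j e2] gives [c11 = -j], [c12 = 1], [c21 = c - j^2]. *)
have E : (- j) ^+ 2 + 1 * (c - j ^+ 2) = c by ring.
rewrite -E; apply: (@adapted_obstruction (e0 - l *: e2) (e1 - j *: e2) e2 a k) => //.
- apply: (semi_change Hlie S (k := 1) (s := 0) (t := - l) (x1 := 1) (y1 := - j) _ _ (esym (comb001 _ _ _)));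
    try (move: (pi ^+ k) => q; ring).
  + by rewrite /comb scale1r scale0r addr0 scaleNr.
  + by rewrite /comb scale1r scale0r add0r scaleNr.
  + by exists 1; ring.
- by constructor 2.
- by rewrite E.
Qed.

End Obstruction.

(** * The listed families *)

Section Presentations.
Variables (p : nat) (p_prime : prime p) (p_ge3 : (3 <= p)%N).
Variables (V : lmodType (padic p)) (br : V -> V -> V) (Hlie : lie_bracket br).
Local Notation R := (padic p).
Local Notation pi := (p%:R : R).
Local Notation x0 := (xb p i0).
Local Notation x1 := (xb p i1).
Local Notation x2 := (xb p i2).

(** * Presentations as semidirect bases *)

Lemma xb_coord a b c : [/\ comb x0 x1 x2 a b c 0 i0 = a, comb x0 x1 x2 a b c 0 i1 = b
  & comb x0 x1 x2 a b c 0 i2 = c].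
Proof.
by split; rewrite /comb !mxE /= ?mulr1 ?mulr0 ?addr0 ?add0r.
Qed.

Lemma xb_comb (r : 'rV[R]_3) : r = comb x0 x1 x2 (r 0 i0) (r 0 i1) (r 0 i2).
Proof.
apply/rowP => j; have [h0 h1 h2] := xb_coord (r 0 i0) (r 0 i1) (r 0 i2).
have : [\/ j = i0, j = i1 | j = i2].
  by case: j => [[|[|[|j]]] hj] //; [constructor 1|constructor 2|constructor 3]; apply: val_inj.
by case=> ->; rewrite ?h0 ?h1 ?h2.
Qed.

Lemma pres_br_comb a11 a21 a12 a22 a b c a' b' c' :
  pres_br (a11 *: x1 + a21 *: x2) (a12 *: x1 + a22 *: x2)
    (comb x0 x1 x2 a b c) (comb x0 x1 x2 a' b' c') =
  comb x0 x1 x2 0 (a * (a11 * b' + a12 * c') - a' * (a11 * b + a12 * c))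
                  (a * (a21 * b' + a22 * c') - a' * (a21 * b + a22 * c)).
Proof.
have E u v : u *: x1 + v *: x2 = comb x0 x1 x2 0 u v by rewrite /comb scale0r add0r.
have [h0 h1 h2] := xb_coord a b c; have [k0 k1 k2] := xb_coord a' b' c'.
rewrite /pres_br h0 h1 h2 k0 k1 k2 !E !combZ combD.
by congr comb; ring.
Qed.

Lemma semi_iso_pres e0 e1 e2 a11 a21 a12 a22 : semi br e0 e1 e2 a11 a21 a12 a22 ->
  iso_pres br (a11 *: x1 + a21 *: x2) (a12 *: x1 + a22 *: x2).
Proof.
move=> S; have [fr _ _ _] := S; have [X [Y [Z [hX hXc]]]] := frame_coords fr.
exists (fun v => comb x0 x1 x2 (X v) (Y v) (Z v)); split.
- exists (fun r : 'rV[R]_3 => comb e0 e1 e2 (r 0 i0) (r 0 i1) (r 0 i2)) => [v|r].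
    by have [-> -> ->] := xb_coord (X v) (Y v) (Z v); rewrite -hX.
  by have [-> -> ->] := hXc (r 0 i0) (r 0 i1) (r 0 i2); rewrite -xb_comb.
- move=> k v w; rewrite combZ combD {1 2 3}(hX v) {1 2 3}(hX w) combZ combD.
  by have [-> -> ->] := hXc (k * X v + X w) (k * Y v + Y w) (k * Z v + Z w).
- move=> v w; rewrite pres_br_comb {1 2 3}(hX v) {1 2 3}(hX w) (semi_br Hlie _ _ _ _ _ _ S).
  by have [-> -> ->] := hXc 0 (X v * (a11 * Y w + a12 * Z w) - X w * (a11 * Y v + a12 * Z v))
      (X v * (a21 * Y w + a22 * Z w) - X w * (a21 * Y v + a22 * Z v)).
Qed.

Lemma iso_pres_semi a11 a21 a12 a22 :
  iso_pres br (a11 *: x1 + a21 *: x2) (a12 *: x1 + a22 *: x2) ->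
  exists e0 e1 e2, semi br e0 e1 e2 a11 a21 a12 a22.
Proof.
case=> f [[g fK gK] flin fbr].
have finj := can_inj fK.
have f0 : f 0 = 0.
  have := flin 1 0 0; rewrite scaler0 addr0 scale1r.
  by move/eqP; rewrite -{1}(addr0 (f 0)) => /eqP/addrI.
have fZ a v : f (a *: v) = a *: f v by have := flin a v 0; rewrite !addr0 f0 addr0.
have fD v w : f (v + w) = f v + f w by have := flin 1 v w; rewrite !scale1r.
have fc a b c : f (comb (g x0) (g x1) (g x2) a b c) = comb x0 x1 x2 a b c.
  by rewrite /comb !fD !fZ !gK.
exists (g x0), (g x1), (g x2); split.
- split=> [v|a b c h].
    exists (f v 0 i0), (f v 0 i1), (f v 0 i2); apply: finj.
    by rewrite fc -xb_comb.
  have := fc a b c; rewrite h f0 => e.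
  have [h0 h1 h2] := xb_coord a b c; rewrite -e !mxE in h0 h1 h2.
  by split.
- apply: finj; rewrite fbr !gK f0.
  have := pres_br_comb a11 a21 a12 a22 0 1 0 0 0 1; rewrite comb010 comb001 => ->.
  by rewrite -(comb000 x0 x1 x2); congr comb; ring.
- apply: finj; rewrite fbr !gK fc.
  have := pres_br_comb a11 a21 a12 a22 1 0 0 0 1 0; rewrite comb010 comb100 => ->.
  by congr comb; ring.
- apply: finj; rewrite fbr !gK fc.
  have := pres_br_comb a11 a21 a12 a22 1 0 0 0 0 1; rewrite comb001 comb100 => ->.
  by congr comb; ring.
Qed.

Lemma iso_L0 : iso_to br (L0 p) <-> exists e0 e1 e2, semi br e0 e1 e2 0 0 0 0.
Proof.
have E : (0 : 'rV[R]_3) = (0 : R) *: x1 + (0 : R) *: x2 by rewrite !scale0r addr0.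
by rewrite /iso_to /= E; split=> [/iso_pres_semi|[e0 [e1 [e2 /semi_iso_pres]]]].
Qed.

Lemma iso_L1 s : iso_to br (L1 p s) <->
  exists e0 e1 e2, semi br e0 e1 e2 (pi ^+ s) 0 0 (pi ^+ s).
Proof.
have E1 : (L1 p s).1 = pi ^+ s *: x1 + (0 : R) *: x2 by rewrite scale0r addr0.
have E2 : (L1 p s).2 = (0 : R) *: x1 + pi ^+ s *: x2 by rewrite scale0r add0r.
by rewrite /iso_to E1 E2; split=> [/iso_pres_semi|[e0 [e1 [e2 /semi_iso_pres]]]].
Qed.

Lemma iso_L2 s r c : iso_to br (L2 s r c) <->
  exists e0 e1 e2, semi br e0 e1 e2 (pi ^+ s) (pi ^+ (s + r) * c) (pi ^+ (s + r)) (pi ^+ s).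
Proof. by split=> [/iso_pres_semi|[e0 [e1 [e2 /semi_iso_pres]]]]. Qed.

Lemma iso_L4 rho s t (eps : bool) : iso_to br (L4 rho s t eps) <->
  exists e0 e1 e2, semi br e0 e1 e2 0 (pi ^+ (s + t) * (if eps then rho else 1)) (pi ^+ s) 0.
Proof.
have E1 : (L4 rho s t eps).1 = (0 : R) *: x1 + (pi ^+ (s + t) * (if eps then rho else 1)) *: x2.
  by rewrite scale0r add0r.
have E2 : (L4 rho s t eps).2 = pi ^+ s *: x1 + (0 : R) *: x2 by rewrite scale0r addr0.
by rewrite /iso_to E1 E2; split=> [/iso_pres_semi|[e0 [e1 [e2 /semi_iso_pres]]]].
Qed.

Lemma iso_L5 s r c : iso_to br (L5 s r c) <->
  exists e0 e1 e2, semi br e0 e1 e2 (pi ^+ (s + r)) (pi ^+ s * c) (pi ^+ s) 0.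
Proof.
have E2 : (L5 s r c).2 = pi ^+ s *: x1 + (0 : R) *: x2 by rewrite scale0r addr0.
by rewrite /iso_to E2; split=> [/iso_pres_semi|[e0 [e1 [e2 /semi_iso_pres]]]].
Qed.

Lemma vp_eq1 (c : R) : vp_eq c 1 <-> exists d, is_unit d /\ c = pi * d.
Proof.
split=> [[[d ->] h]|[d [hd ->]]].
  exists d; rewrite expr1; split=> //; case: (unit_or_pdvd p_prime d) => // -[x e].
  by case: h; exists x; rewrite e expr1 exprS expr1 mulrA.
split; first by exists d; rewrite expr1.
case=> x; rewrite exprS expr1 -mulrA => /(pmul_inj p_prime) e.
by apply: (unit_pdvdF p_prime hd); exists x.
Qed.

Lemma index_p_scalar e0 e1 e2 a : semi br e0 e1 e2 a 0 0 a -> a <> 0 ->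
  self_similar_of_index br p.
Proof.
move=> S na; apply: (index_p_swap p_prime Hlie S (u := 1) (e := 1) (b21 := 0)).
- by exists 1; rewrite mulr1.
- by rewrite mulr0.
- by rewrite mul1r.
- by rewrite mul1r.
- by rewrite !mulr0.
- by rewrite !mulr0.
- by case.
Qed.

(** * The listed lattices have simple endomorphisms of index [p] *)

Lemma pexp_neq0 k : pi ^+ k <> 0.
Proof.
move=> e; apply: (is_unit_neq0 p_prime (x := 1)); first by exists 1; rewrite mulr1.
by apply: (@pexp_mul_eq0 _ p_prime k); rewrite e mul0r.
Qed.

Lemma index_p_ramified e0 e1 e2 a k d : is_unit d ->
  semi br e0 e1 e2 a (pi ^+ k * (pi * d)) (pi ^+ k) a -> self_similar_of_index br p.
Proof.
move=> [i hi] S.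
apply: (index_p_swap p_prime Hlie S (u := 1) (e := i) (b21 := pi ^+ k * d)).
- by exists d; rewrite mulrC.
- by rewrite mulrCA.
- by rewrite mul1r.
- by rewrite mul1r.
- by rewrite mul1r mulrCA (mulrC i) hi mulr1.
- by rewrite mul1r mulrCA (mulrC i) hi mulr1.
- by case=> _ _ /pexp_neq0.
Qed.

Lemma index_p_split e0 e1 e2 k : semi br e0 e1 e2 0 (pi ^+ k) (pi ^+ k) 0 ->
  self_similar_of_index br p.
Proof.
move=> S.
(* [e1 + e2] and [e1 - e2] are eigenvectors with opposite eigenvalues, and form a basis because the
   determinant -2 is a unit. *)
have S' : semi br e0 (comb e0 e1 e2 0 1 1) (comb e0 e1 e2 0 1 (-1)) (pi ^+ k) 0 0 (- pi ^+ k).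
  apply: (semi_change Hlie S (esym (comb100 e0 e1 e2)) erefl erefl);
    try (move: (pi ^+ k) => q; ring).
  congr is_unit: (is_unitN (two_unit p_prime p_ge3)); ring.
apply: (index_p_swap p_prime Hlie S' (u := -1) (e := 1) (b21 := 0)).
- by exists 1; rewrite mulr1.
- by rewrite mulr0.
- by rewrite mulN1r opprK.
- by rewrite mulN1r.
- by rewrite !mulr0.
- by rewrite !mulr0.
- by case=> /pexp_neq0.
Qed.

(** Completing the square: the traceless part of [A / p^s] squares to [c + p^(2r) / 4]. Its
    valuation is 1 when that of [c] is and [r >= 1]; for [r = 0] it is the valuation of [4c + 1]. *)
Lemma index_p_L5 e0 e1 e2 s r c : semi br e0 e1 e2 (pi ^+ (s + r)) (pi ^+ s * c) (pi ^+ s) 0 ->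
  ((1 <= r)%N /\ vp_eq c 1) \/ (r = 0%N /\ vp_eq (4%:R * c + 1) 1) ->
  self_similar_of_index br p.
Proof.
move=> S hr; have u2 := two_unit p_prime p_ge3; have [h hh] := u2.
have uh : is_unit h by exists 2%:R; rewrite mulrC.
have [d [ud ed]] : exists d, is_unit d /\ c + (h * pi ^+ r) ^+ 2 = pi * d.
  case: hr => [[r1 /vp_eq1 [d [ud ->]]]|[-> /vp_eq1 [d [ud e]]]].
    exists (d + pi * (h * pi ^+ r.-1) ^+ 2); split.
      by apply: is_unit_pdvdD => //; exact: pdvdp.
    have -> : pi ^+ r = pi * pi ^+ r.-1 by rewrite -exprS prednK.
    by move: (pi ^+ r.-1) => q; ring.
  exists (h ^+ 2 * d); split; first by apply: is_unitM => //; rewrite expr2; apply: is_unitM.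
  rewrite mulrCA -e expr0 mulr1.
  transitivity ((2%:R * h) ^+ 2 * c + h ^+ 2); last by ring.
  by rewrite hh; ring.
have S' : semi br e0 (comb e0 e1 e2 0 1 (- (h * pi ^+ r))) e2 (h * pi ^+ (s + r))
    (pi ^+ s * (pi * d)) (pi ^+ s) (h * pi ^+ (s + r)).
  apply: (semi_change Hlie S (esym (comb100 e0 e1 e2)) erefl (esym (comb001 e0 e1 e2)));
    rewrite -?ed ?exprD.
  - by exists 1; ring.
  - transitivity (2%:R * h * (pi ^+ s * pi ^+ r) - h * (pi ^+ s * pi ^+ r)).
      by rewrite hh; move: (pi ^+ s) (pi ^+ r) => q t; ring.
    by move: (pi ^+ s) (pi ^+ r) => q t; ring.
  - by move: (pi ^+ s) (pi ^+ r) => q t; ring.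
  - by move: (pi ^+ s) (pi ^+ r) => q t; ring.
  - by move: (pi ^+ s) (pi ^+ r) => q t; ring.
exact: index_p_ramified S'.
Qed.

Definition listed (rho : R) : Prop :=
  iso_to br (L0 p) \/
  (exists s : nat, iso_to br (L1 p s)) \/
  (exists (s r : nat) (c : padic p), (1 <= r)%N /\ vp_eq c 1 /\ iso_to br (L2 s r c)) \/
  (exists (s t : nat) (eps : bool),
    (t = 1%N \/ (t = 0%N /\ eps = false)) /\ iso_to br (L4 rho s t eps)) \/
  (exists (s r : nat) (c : padic p),
    (((1 <= r)%N /\ vp_eq c 1) \/ (r = 0%N /\ vp_eq (4%:R * c + 1) 1))
    /\ iso_to br (L5 s r c)).

Lemma listed_index_p rho : is_unit rho -> listed rho -> self_similar_of_index br p.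
Proof.
move=> urho [/iso_L0 [e0 [e1 [e2 S]]]|[[s /iso_L1 [e0 [e1 [e2 S]]]]|[|[|]]]].
- exact: index_p_abelian S.
- exact: index_p_scalar S (@pexp_neq0 s).
- move=> [s [r [c [r1 [/vp_eq1 [d [ud ->]] /iso_L2 [e0 [e1 [e2 S]]]]]]]].
  exact: index_p_ramified ud S.
- move=> [s [t [eps [[->|[-> ->]] /iso_L4 [e0 [e1 [e2 S]]]]]]].
    rewrite addn1 exprSr -mulrA in S; apply: index_p_ramified S.
    by case: eps => //; exists 1; rewrite mulr1.
  by rewrite addn0 mulr1 in S; apply: index_p_split S.
- by move=> [s [r [c [hr /iso_L5 [e0 [e1 [e2 S]]]]]]]; apply: index_p_L5 S hr.
Qed.

(** * Recognition of the families *)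

Lemma scalar_listed rho e0 e1 e2 a : semi br e0 e1 e2 a 0 0 a -> listed rho.
Proof.
move=> S; case: (pselect (a = 0)) => [a0|/(padic_val p_prime) [s [u [[i hi] ea]]]].
  by left; apply/iso_L0; exists e0, e1, e2; rewrite a0 in S.
right; left; exists s; apply/iso_L1.
exists (comb e0 e1 e2 i 0 0), e1, e2.
apply: (semi_change Hlie S erefl (esym (comb010 e0 e1 e2)) (esym (comb001 e0 e1 e2))); rewrite ?ea; try ring.
- by exists u; rewrite mulr1 mulr0 subr0 mulr1 mulrC.
- transitivity (u * i * pi ^+ s); first by move: (pi ^+ s) => q; ring.
  by rewrite hi; ring.
- transitivity (u * i * pi ^+ s); first by move: (pi ^+ s) => q; ring.
  by rewrite hi; ring.
Qed.

(** Rescaling [e0] by a unit normalizes [a], or [d] up to squares when [a = 0]. The family depends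
    on [l = v_p(a)]: [L4] for [a = 0], [L2] for [l < k], and [L5] for [l >= k], where [p^k] divides
    the whole matrix. *)
Lemma ramified_listed rho e0 e1 e2 a k d :
  is_unit rho -> (~ exists y, pdvd (rho - y ^+ 2)) -> is_unit d ->
  semi br e0 e1 e2 a (pi ^+ k * (pi * d)) (pi ^+ k) a -> listed rho.
Proof.
move=> urho nsq ud S; have u2 := two_unit p_prime p_ge3.
have E2 := esym (comb001 e0 e1 e2).
case: (pselect (a = 0)) => [a0|/(padic_val p_prime) [l [a' [ua' ea]]]].
  right; right; right; left.
  have [e [[i hi] he]] := unit_sq_class p_prime p_ge3 urho nsq ud.
  have ui : is_unit i by exists e; rewrite mulrC.
  have [eps heps] : exists eps : bool, d = (if eps then rho else 1) * e ^+ 2.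
    by case: he => ->; [exists false; rewrite mul1r|exists true].
  exists k, 1%N, eps; split; first by left.
  apply/iso_L4; exists (comb e0 e1 e2 i 0 0), (comb e0 e1 e2 0 i 0), e2.
  rewrite a0 in S; apply: (semi_change Hlie S erefl erefl E2); try (move: (pi ^+ k) => q; ring).
    by congr is_unit: (is_unitM ui ui); ring.
  rewrite addn1 exprSr heps.
  transitivity ((e * i) ^+ 2 * (pi ^+ k * pi * (if eps then rho else 1))).
    by move: (pi ^+ k) (if eps then _ else _) => q r; ring.
  by rewrite hi; move: (pi ^+ k) (if eps then _ else _) => q r; ring.
have [i hi] := ua'; have ui : is_unit i by exists a'; rewrite mulrC.
case: (ltnP l k) => lk.
  right; right; left; exists l, (k - l)%N, (pi * (i ^+ 2 * d)); split; first by rewrite subn_gt0.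
  split.
    by apply/vp_eq1; exists (i ^+ 2 * d); split=> //; apply: is_unitM => //; rewrite expr2; apply: is_unitM.
  apply/iso_L2; exists (comb e0 e1 e2 i 0 0), (comb e0 e1 e2 0 i 0), e2; rewrite subnKC 1?ltnW //.
  apply: (semi_change Hlie S erefl erefl E2); rewrite ?ea; try (move: (pi ^+ k) => q; ring).
  - by congr is_unit: (is_unitM ui ui); ring.
  - transitivity (a' * i * (pi ^+ l * i)); first by move: (pi ^+ l) => q; ring.
    by rewrite hi; move: (pi ^+ l) => q; ring.
  - transitivity (a' * i * (pi ^+ l)); first by move: (pi ^+ l) (pi ^+ k) => q t; ring.
    by rewrite hi; move: (pi ^+ l) (pi ^+ k) => q t; ring.
right; right; right; right.
have [h hh] := u2; have uh : is_unit h by exists 2%:R; rewrite mulrC.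
(* [j = 1/(2 a')] turns the trace [2 a' p^l] into [p^l], the trace in [L5]. *)
pose j := h * i; have uj : is_unit j by apply: is_unitM.
have hj : 2%:R * a' * j = 1.
  by transitivity ((2%:R * h) * (a' * i)); [rewrite /j; ring|rewrite hh hi mulr1].
pose P := pi ^+ (l - k).
have Pl : pi ^+ l = pi ^+ k * P by rewrite /P -exprD subnKC.
(* The parameter is minus the determinant of [A], rescaled by [j^2] and divided by [p^(2k)]. When
   [l = k], the identity [2 a' j = 1] turns [4c + 1] into [4 j^2 p d]. *)
exists k, (l - k)%N, (j ^+ 2 * (pi * d - P ^+ 2 * a' ^+ 2)); split.
  have [r0|r0] := posnP (l - k)%N.
    right; split=> //; apply/vp_eq1; exists (2%:R * 2%:R * j ^+ 2 * d); split.
      by do !apply: is_unitM => //; rewrite expr2; apply: is_unitM.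
    rewrite /P r0 expr0; apply: subr0_eq.
    transitivity (1 - (2%:R * a' * j) ^+ 2); first by ring.
    by rewrite hj expr1n subrr.
  left; split=> //; apply/vp_eq1.
  exists (j ^+ 2 * (d + pi * (- (pi ^+ (l - k).-1 * a') ^+ 2))); split.
    apply: is_unitM; first by rewrite expr2; apply: is_unitM.
    by apply: is_unit_pdvdD => //; exact: pdvdp.
  have -> : P = pi * pi ^+ (l - k).-1 by rewrite /P -exprS prednK.
  by move: (pi ^+ _) => q; ring.
apply/iso_L5; exists (comb e0 e1 e2 j 0 0), (comb e0 e1 e2 0 j (j * P * a')), e2.
rewrite subnKC // Pl; rewrite Pl in ea.
move: (pi ^+ k) P {Pl} S ea => q P S ea.
apply: (semi_change Hlie S erefl erefl E2); rewrite ?ea; try ring.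
- by congr is_unit: (is_unitM uj uj); ring.
- transitivity (2%:R * a' * j * (q * P * j)); first by ring.
  by rewrite hj; ring.
- transitivity (2%:R * a' * j * (j * q * P ^+ 2 * a') + q * (j ^+ 2 * (pi * d - P ^+ 2 * a' ^+ 2))); first by ring.
  by rewrite hj; ring.
Qed.

Lemma split_listed rho e0 e1 e2 k g : is_unit g ->
  semi br e0 e1 e2 0 (pi ^+ k * g ^+ 2) (pi ^+ k) 0 -> listed rho.
Proof.
move=> [i hi] S; have ui : is_unit i by exists g; rewrite mulrC.
right; right; right; left; exists k, 0%N, false; split; first by right.
apply/iso_L4; exists (comb e0 e1 e2 i 0 0), (comb e0 e1 e2 0 i 0), e2; rewrite addn0 mulr1.
apply: (semi_change Hlie S erefl erefl (esym (comb001 e0 e1 e2))); try (move: (pi ^+ k) => q; ring).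
  by congr is_unit: (is_unitM ui ui); ring.
transitivity ((g * i) ^+ 2 * pi ^+ k); first by move: (pi ^+ k) => q; ring.
by rewrite hi; move: (pi ^+ k) => q; ring.
Qed.

End Presentations.

Theorem theorem1p22 (p : nat) (p_prime : prime p) (p_ge3 : (3 <= p)%N)
    (rho : padic p)
    (rho_unit : exists u : padic p, rho * u = 1)
    (rho_nonsq : ~ exists y : padic p, pdivides 1 (rho - y ^+ 2))
    (V : lmodType (padic p)) (br : V -> V -> V)
    (Hlie : lie_bracket br) (Hdim : free_of_rank V 3) (Hsolv : solvable br) :
  exists sigma : nat,
    [/\ ss_index br sigma,
        sigma = p \/ sigma = (p ^ 2)%N &
        (sigma = p <->
           (iso_to br (L0 p) \/
               (exists s : nat, iso_to br (L1 p s)) \/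
               (exists (s r : nat) (c : padic p),
                 (1 <= r)%N /\ vp_eq c 1 /\ iso_to br (L2 s r c)) \/
               (exists (s t : nat) (eps : bool),
                 (t = 1%N \/ (t = 0%N /\ eps = false)) /\ iso_to br (L4 rho s t eps)) \/
               (exists (s r : nat) (c : padic p),
                 (((1 <= r)%N /\ vp_eq c 1) \/ (r = 0%N /\ vp_eq (4%:R * c + 1) 1))
                 /\ iso_to br (L5 s r c))))].
Proof.
have nsq : ~ exists y, pdvd (rho - y ^+ 2).
  by move=> [y [d e]]; apply: rho_nonsq; exists y, d; rewrite expr1.
have [e0 [e1 [e2 [a NF]]]] := normal_form p_prime p_ge3 Hlie Hdim Hsolv.
have fr : frame e0 e1 e2 by case: NF => [[]|[k [c []]]].
have not1 := index1_not_simple p_prime (br := br) fr.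
have ss_listed : self_similar_of_index br p -> listed br rho.
  move=> ss; case: NF => [S|[k [c S]]]; first exact: scalar_listed S.
  have [M [phi [ve idx simp]]] := ss.
  case: (index_p_obstruction p_prime p_ge3 Hlie ve idx simp S) => [[d [ud ec]]|[a0 [g [ug ec]]]].
    by rewrite ec in S; apply: ramified_listed S.
  by rewrite a0 ec in S; apply: split_listed S.
have listed_ss := listed_index_p p_prime p_ge3 Hlie rho_unit.
have p1 := prime_gt1 p_prime.
case: (pselect (self_similar_of_index br p)) => ss.
  exists p; split; [|by left|by split=> // _; exact: ss_listed].
  split; first by exists 1%N; rewrite expn1.
  case=> [|k] h; first by case: not1.
  by rewrite -{1}(expn1 p) leq_exp2l.
have nlisted : ~ listed br rho by move/listed_ss.
exists (p ^ 2)%N; split; [|by right|].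
  split.
    (* A scalar action is always listed, so the action is in companion form and has the non-zero
       entry [p^k]. *)
    exists 2%N; split=> //; case: NF => [S|[k [c S]]]; first by case: nlisted; exact: scalar_listed S.
    by apply: (index_p2 p_prime Hlie S) => -[_ _ /(pexp_neq0 p_prime)].
  case=> [|[|k]] h; [by case: not1|by case: ss; rewrite expn1 in h|].
  by rewrite leq_exp2l.
split=> [e|/nlisted //]; exfalso; move: e; rewrite -{2}(expn1 p) => /eqP.
by rewrite eqn_exp2l.
Qed.
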